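(* Let $X$ be a centered infinitely divisible random vector in $\mathbb{R}^d$ with finite second moment, and let $t\in\mathbb{R}^d$ satisfy $V_X(t)>0$. Let $R_t=BY_t$ be the directional remainder variable defined in the context. Then for every $s\ge 0$, with extended values ($+\infty$) allowed, $$K_X(st)=\frac{V_X(t)s^2}{2}\,M_t(s),\qquad M_t(s):=\mathbb{E}\,e^{sR_t}.$$ Moreover, for every $r\in\mathbb{R}$, the characteristic exponent satisfies $$\Psi_X(rt):=\log\mathbb{E}\,e^{ir\langle t,X\rangle}=-\frac{V_X(t)r^2}{2}\,\varphi_t(r),\qquad \varphi_t(r):=\mathbb{E}\,e^{irR_t}.$$
   Context: $X$ is a centered infinitely divisible random vector in $\mathbb{R}^d$ with finite second moment; $A$ is the covariance matrix of its Gaussian component and $\nu$ its Lévy measure. With the drift chosen to center $X$, the cumulant is $$K_X(t):=\log\mathbb{E}e^{\langle t,X\rangle}=\tfrac12 t^\top A t+\int_{\mathbb{R}^d}\bigl(e^{\langle t,x\rangle}-1-\langle t,x\rangle\bigr)\,\nu(dx),$$ taking the value $+\infty$ where the expectation is infinite. The covariance matrix is $\Sigma=A+\int xx^\top\,\nu(dx)$ and $V_X(t):=t^\top\Sigma t$. The characteristic exponent $\Psi_X$ is the continuous (Lévy–Khintchine) logarithm of the characteristic function, with $\Psi_X(0)=0$. For $t$ with $V_X(t)>0$, let $H_t$ be the finite measure on $\mathbb{R}$ given by $$H_t(S)=(t^\top A t)\mathbf 1_{\{0\in S\}}+\int_{\mathbb{R}^d}\mathbf 1_{\{\langle t,x\rangle\in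 S\}}\langle t,x\rangle^2\,\nu(dx),$$ which has total mass $V_X(t)$. Let $Y_t$ have distribution $H_t/V_X(t)$, let $B$ be independent of $Y_t$ with density $2(1-b)\mathbf 1_{(0,1)}(b)$ (i.e. $\mathrm{Beta}(1,2)$), and set $R_t=BY_t$. *)

(* Defs.v *)
From HB Require Import structures.
From mathcomp Require Import all_boot all_order all_algebra.
From mathcomp Require Import complex.
From mathcomp Require Import all_classical all_reals all_analysis.

Set Implicit Arguments.
Unset Strict Implicit.
Unset Printing Implicit Defensive.

Import Order.TTheory GRing.Theory Num.Theory.
Import numFieldNormedType.Exports.

Local Open Scope classical_set_scope.
Local Open Scope ring_scope.

(* Points of R^n that carry a law are of type [n.-tuple R], whose sigma-algebra
   is the product (Borel) one; dual variables t are row vectors, which carry the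
   vector space structure and the topology. *)

Definition dotp (R : realType) (n : nat) (t : 'rV[R]_n) (x : n.-tuple R) : R :=
  \sum_(i < n) t 0 i * tnth x i.

Definition sqnorm (R : realType) (n : nat) (x : n.-tuple R) : R :=
  \sum_(i < n) tnth x i ^+ 2.

Definition qform (R : realType) (n : nat) (A : 'M[R]_n) (t : 'rV[R]_n) : R :=
  (t *m A *m t^T) 0 0.

Definition cexp (R : realType) (z : R[i]) : R[i] :=
  Complex (expR (complex.Re z) * cos (complex.Im z))
          (expR (complex.Re z) * sin (complex.Im z)).

Definition cintegral (d : measure_display) (T : measurableType d) (R : realType)
    (mu : {measure set T -> \bar R}) (f : T -> R[i]) : R[i] :=
  Complex (\int[mu]_x complex.Re (f x)) (\int[mu]_x complex.Im (f x)).

Section RandomVector.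
Context (d : measure_display) (T : measurableType d) (R : realType).
Context (P : probability T R) (n : nat) (X : {RV P >-> n.-tuple R}).

Definition centered : Prop :=
  forall i : 'I_n, ('E_P[fun w => tnth (X w) i])%E = 0%E.

Definition finite_second_moment : Prop :=
  ('E_P[fun w => sqnorm (X w)] < +oo)%E.

Definition covariance_matrix : 'M[R]_n :=
  \matrix_(i, j)
    fine (covariance P (fun w => tnth (X w) i) (fun w => tnth (X w) j)).

Definition Vfun (t : 'rV[R]_n) : R := qform covariance_matrix t.

Definition cumulant (t : 'rV[R]_n) : \bar R :=
  lne ('E_P[fun w => expR (dotp t (X w))])%E.

Definition charfun (t : 'rV[R]_n) : R[i] :=
  cintegral P (fun w => cexp (Complex 0 (dotp t (X w)))).

Definition is_char_exponent (Psi : 'rV[R]_n -> R[i]) : Prop :=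
  [/\ continuous (fun t => complex.Re (Psi t)),
      continuous (fun t => complex.Im (Psi t)),
      Psi 0 = 0 &
      forall t, cexp (Psi t) = charfun t].

(* A function satisfying [is_char_exponent] is unique; it exists whenever the
   characteristic function does not vanish. *)
Definition char_exponent : 'rV[R]_n -> R[i] :=
  xget (fun _ => 0) [set Psi | is_char_exponent Psi].

End RandomVector.

Definition mutually_independent (d d' : measure_display) (T : measurableType d)
    (T' : measurableType d') (R : realType) (P : probability T R) (m : nat)
    (Y : 'I_m -> {RV P >-> T'}) : Prop :=
  forall S : 'I_m -> set T', (forall j, measurable (S j)) ->
    P (\bigcap_(j in [set: 'I_m]) (Y j @^-1` S j)) =
    (\prod_(j < m) P (Y j @^-1` S j))%E.

Definition infinitely_divisible (d : measure_display) (T : measurableType d)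
    (R : realType) (P : probability T R) (n : nat)
    (X : {RV P >-> n.-tuple R}) : Prop :=
  forall m : nat, (0 < m)%N ->
  exists (d' : measure_display) (T' : measurableType d') (Q : probability T' R)
         (Y : 'I_m -> {RV Q >-> n.-tuple R}),
  [/\ mutually_independent Y,
      forall j k S, measurable S -> distribution Q (Y j) S = distribution Q (Y k) S &
      forall S, measurable S ->
        distribution P X S =
        Q ((fun w => [tuple \sum_(j < m) tnth (Y j w) i | i < n]) @^-1` S)].

Definition levy_measure (R : realType) (n : nat)
    (nu : {measure set (n.-tuple R) -> \bar R}) : Prop :=
  nu [set x | forall i, tnth x i = 0] = 0%E /\
  (\int[nu]_x (Num.min 1 (sqnorm x))%:E < +oo)%E.

(* The generating triplet of X is (A, nu, gamma), with respect to the
   truncation 1_{|x| <= 1}; only the drift gamma depends on the truncation. *)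
Definition gaussian_levy_pair (d : measure_display) (T : measurableType d)
    (R : realType) (P : probability T R) (n : nat) (X : {RV P >-> n.-tuple R})
    (A : 'M[R]_n) (nu : {measure set (n.-tuple R) -> \bar R}) : Prop :=
  [/\ A^T = A, forall u, 0 <= qform A u, levy_measure nu &
    exists gamma : n.-tuple R, forall t : 'rV[R]_n,
      charfun X t =
      cexp (Complex (- (qform A t / 2)) (dotp t gamma)
            + cintegral nu (fun x =>
                cexp (Complex 0 (dotp t x)) - 1
                - Complex 0 (dotp t x * (sqnorm x <= 1)%R%:R)))].

Definition Hmeas (R : realType) (n : nat) (A : 'M[R]_n)
    (nu : {measure set (n.-tuple R) -> \bar R}) (t : 'rV[R]_n)
    (S : set R) : \bar R :=
  ((qform A t)%:E * \d_(0%R : R) S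
   + \int[nu]_(x in [set x | S (dotp t x)]) (dotp t x ^+ 2)%:E)%E.

Definition independent_pair (d : measure_display) (T : measurableType d)
    (R : realType) (Q : probability T R) (B Y : {RV Q >-> R}) : Prop :=
  forall S1 S2 : set R, measurable S1 -> measurable S2 ->
    Q ((B @^-1` S1) `&` (Y @^-1` S2)) = (Q (B @^-1` S1) * Q (Y @^-1` S2))%E.

Definition beta12_law (d : measure_display) (T : measurableType d)
    (R : realType) (Q : probability T R) (B : {RV Q >-> R}) : Prop :=
  forall S : set R, measurable S ->
    distribution Q B S =
    (\int[lebesgue_measure]_(b in S) (2 * (1 - b) * \1_`]0%R, 1%R[ b)%:E)%E.

Definition cf (d : measure_display) (T : measurableType d) (R : realType)
    (Q : probability T R) (Z : T -> R) (r : R) : R[i] :=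
  cintegral Q (fun w => cexp (Complex 0 (r * Z w))).

(* Main.v *)
(** Write [Z = <t,X>] and [W = (1 - (1-B)^2) Y], where [1 - (1-B)^2] is uniform
    on the unit interval.  By Taylor's formula with integral remainder,
    [exp (i y) - 1 - i y = - y^2 / 2 * E exp (i B y)], and [Y] has the law of a
    directional jump reweighted by its square; so the Levy-Khintchine exponent of
    [Z] is [- V r^2 / 2 * E exp (i r B Y)], and it is the continuous logarithm by
    uniqueness of liftings along the ray.

    For the cumulant, differentiating the characteristic function and using that
    finite measures are determined by their Fourier transforms gives the zero-bias
    identity [E (Z^2 g(U Z)) = V E g(Z + W)] for every [g >= 0] ([U] uniform and
    independent of [Z], [W] independent of [Z]).  With [g = exp (s .)] it says
    that the moment generating function [f] and [K s = V s^2 / 2 * E exp (s B Y)]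
    satisfy [f' = K' f] in an integrated form that makes sense with infinite
    values; monotonicity of [f'] then forces [ln f = K] wherever [f] is finite,
    and truncated exponentials for [g] show that [f] is finite wherever [K] is. *)

From HB Require Import structures.
Require Import Defs.
From mathcomp Require Import all_boot all_order all_algebra.
From mathcomp Require Import complex.
From mathcomp Require Import all_classical all_reals all_analysis.
From mathcomp Require Import measurable_realfun ring lra.

Import Order.TTheory GRing.Theory Num.Theory.
Import numFieldNormedType.Exports.

Local Open Scope classical_set_scope.
Local Open Scope ring_scope.

Set Implicit Arguments.
Unset Strict Implicit.
Unset Printing Implicit Defensive.

(** The cumulant is reached through an equality of finite measures, which Fourier transforms
    determine and which can afterwards be integrated against any nonnegative function, with value
    +oo allowed. What makes the two sides comparable is that [expR (s * z) - 1 - s * z] is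
    [z ^+ 2 * exp_rem2 s z] with [exp_rem2] nonnegative for [s >= 0]: as E Z = 0, the moment
    generating function is 1 plus the integral of [exp_rem2 s] against the law of Z weighted by Z^2,
    and K is the integral of the same kernel against V times the law of Y. Secant inequalities of
    that kernel in s replace derivatives, which might be infinite. Two facts are extracted on the
    way: the second moment of the jumps along t is finite, by the total mass of the law of Y, and
    the drift left after full compensation of the jumps is 0, by the derivative at 0 of the
    characteristic function. *)

Section Derivatives.
Context {R : realType}.
Implicit Types (f g : R -> R) (x df dg : R).

Lemma derive_cst x (c : R) : is_derive x 1 (fun=> c) 0.
Proof. exact: is_derive_cst. Qed.

Lemma derive_id x : is_derive x 1 (fun y : R => y) 1.
Proof. exact: is_derive_id. Qed.

Lemma derive_add f g x df dg : is_derive x 1 f df -> is_derive x 1 g dg ->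
  is_derive x 1 (fun y => f y + g y) (df + dg).
Proof. exact: is_deriveD. Qed.

Lemma derive_opp f x df : is_derive x 1 f df ->
  is_derive x 1 (fun y => - f y) (- df).
Proof. exact: is_deriveN. Qed.

Lemma derive_mul f g x df dg : is_derive x 1 f df -> is_derive x 1 g dg ->
  is_derive x 1 (fun y => f y * g y) (f x * dg + g x * df).
Proof. exact: is_deriveM. Qed.

Lemma derive_cos f x df : is_derive x 1 f df ->
  is_derive x 1 (fun y => cos (f y)) (- sin (f x) * df).
Proof. by move=> h; exact: (@is_derive1_comp _ cos f). Qed.

Lemma derive_sin f x df : is_derive x 1 f df ->
  is_derive x 1 (fun y => sin (f y)) (cos (f x) * df).
Proof. by move=> h; exact: (@is_derive1_comp _ sin f). Qed.

Lemma derive_exp f x df : is_derive x 1 f df ->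
  is_derive x 1 (fun y => expR (f y)) (expR (f x) * df).
Proof. by move=> h; exact: (@is_derive1_comp _ expR f). Qed.

Lemma derive_atan f x df : is_derive x 1 f df ->
  is_derive x 1 (fun y => atan (f y)) ((1 + f x ^+ 2)^-1 * df).
Proof. by move=> h; exact: (@is_derive1_comp _ atan f). Qed.

Lemma is_derive_continuous f (df : R -> R) : (forall x, is_derive x 1 f (df x)) ->
  continuous f.
Proof.
move=> h x; apply: differentiable_continuous; apply/derivable1_diffP.
by have [] := h x.
Qed.

End Derivatives.

(** The derivative is left as an existential variable which the rules fill in; the remaining goal
    compares it with the announced value. *)
Ltac derive := notypeclasses refine (is_derive_eq _ _); [repeat first
  [ exact: derive_cst | exact: derive_id | apply: derive_opp
  | apply: derive_add | apply: derive_mul | apply: derive_cos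
  | apply: derive_sin | apply: derive_exp | apply: derive_atan ] |];
  rewrite ?/GRing.scale /=.

(** * Integrability, dominated convergence and differentiation under the integral *)

Section Measures.
Context (d : measure_display) (T : measurableType d) (R : realType).
Variable m : {measure set T -> \bar R}.
Implicit Types f g : T -> R.

Lemma bounded_integrable f C : (m setT < +oo)%E -> measurable_fun setT f ->
  (forall x, `|f x| <= C) -> m.-integrable setT (EFin \o f).
Proof.
move=> mfin mf fC; apply: measurable_bounded_integrable => //.
exists C; split => [|M CM]; first exact: num_real.
by move=> x _; exact: le_trans (fC x) (ltW CM).
Qed.

Lemma ge0_le_integrable f g : measurable_fun setT f ->
  (forall x, `|f x| <= g x) -> m.-integrable setT (EFin \o g) ->
  m.-integrable setT (EFin \o f).
Proof.
move=> mf fg; apply: le_integrable => //; first exact/measurable_EFinP.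
by move=> x _; rewrite /= lee_fin (le_trans (fg x)) ?ler_norm.
Qed.

Lemma integrable_addf f g : m.-integrable setT (EFin \o f) ->
  m.-integrable setT (EFin \o g) ->
  m.-integrable setT (EFin \o (fun x => f x + g x)).
Proof. by move=> hf hg; exact: (integrableD measurableT hf hg). Qed.

Lemma integrable_subf f g : m.-integrable setT (EFin \o f) ->
  m.-integrable setT (EFin \o g) ->
  m.-integrable setT (EFin \o (fun x => f x - g x)).
Proof. by move=> hf hg; exact: (integrableB measurableT hf hg). Qed.

Lemma integrable_scalef c f : m.-integrable setT (EFin \o f) ->
  m.-integrable setT (EFin \o (fun x => c * f x)).
Proof. by move=> hf; exact: (integrableZl measurableT c hf). Qed.

Lemma integrable_measurable f : m.-integrable setT (EFin \o f) ->
  measurable_fun setT f.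
Proof. by move=> /measurable_int/measurable_EFinP. Qed.

Lemma EFin_Rintegral f : m.-integrable setT (EFin \o f) ->
  (\int[m]_x f x)%:E = (\int[m]_x (f x)%:E)%E.
Proof. by move=> intf; rewrite fineK//; exact: integrable_fin_num. Qed.

Lemma integrable_ge0_lty f : measurable_fun setT f -> (forall x, 0 <= f x) ->
  (\int[m]_x (f x)%:E < +oo)%E -> m.-integrable setT (EFin \o f).
Proof.
move=> mf f0 fy; apply/integrableP; split; first exact/measurable_EFinP.
by under eq_integral do rewrite /= ger0_norm//.
Qed.

Lemma dominated_cvg_Rintegral (F : nat -> T -> R) f g :
  (forall n, measurable_fun setT (F n)) -> measurable_fun setT f ->
  m.-integrable setT (EFin \o g) -> (forall n x, `|F n x| <= g x) ->
  (forall x, F ^~ x @ \oo --> f x) ->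
  (fun n => \int[m]_x F n x) @ \oo --> \int[m]_x f x.
Proof.
move=> mF mf ig Fg Ff; apply: fine_cvg.
have [] // := @dominated_convergence _ _ _ m setT measurableT
  (fun n x => (F n x)%:E) (EFin \o f) (EFin \o g).
- by move=> n; exact/measurable_EFinP.
- exact/measurable_EFinP.
- by apply: aeW => x _; apply: cvg_EFin; [exact: nearW|exact: Ff].
- by apply: aeW => x n _; rewrite /= lee_fin.
- move=> intf _; rewrite fineK//; exact: integrable_fin_num.
Qed.

(** Leibniz rule on the window of radius 1 around [a]. A fixed radius suffices because the families
    below have dominating functions that are locally uniform in the parameter. *)
Lemma is_derive_Rintegral (f f' : R -> T -> R) (G : T -> R) (a : R) :
  (forall x, m.-integrable setT (EFin \o f x)) ->
  (forall (x : R) y, is_derive x 1 (f ^~ y) (f' x y)) ->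
  m.-integrable setT (EFin \o G) ->
  (forall x y, `|x - a| < 1 -> `|f' x y| <= G y) ->
  is_derive a 1 (fun x => \int[m]_y f x y) (\int[m]_y f' a y).
Proof.
move=> intf df intG fG.
have Ia : `]a - 1, a + 1[%classic a by rewrite /= in_itv/=; apply/andP; split; lra.
have d1 x y : partial1of2 f x y = f' x y.
  by rewrite partial1of2E; have [_] := df x y.
have G0 y : 0 <= G y by rewrite (le_trans _ (fG a y _))// subrr normr0.
have IG x y : `]a - 1, a + 1[%classic x -> setT y -> `|partial1of2 f x y| <= G y.
  move=> /=; rewrite in_itv/= => /andP[h1 h2] _.
  by rewrite d1 fG// ltr_norml; apply/andP; split; lra.
have df1 x y : `]a - 1, a + 1[%classic x -> setT y -> derivable (f ^~ y) x 1.
  by move=> _ _; have [] := df x y.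
split.
  exact: (derivable_under_integral measurableT Ia (fun x _ => intf x) df1 G0 intG IG).
rewrite -derive1E (differentiation_under_integral measurableT Ia
  (fun x _ => intf x) df1 G0 intG IG).
by apply: eq_Rintegral => y _; exact: d1.
Qed.

End Measures.

Lemma derive0_eq (R : realType) (f : R -> R) :
  (forall x : R, is_derive x 1 f 0) -> forall x y, f x = f y.
Proof. by move=> h x y; exact: is_derive_0_is_cst. Qed.

(** * Image of a measure under a map, after reweighting by a density *)

Section WeightedLaw.
Local Open Scope ereal_scope.
Context (d d' : measure_display) (T : measurableType d) (T' : measurableType d').
Context (R : realType) (mu : {measure set T -> \bar R}).

Import HBNNSimple.

(** [m] has density [f]. The formula holds for simple [g] by linearity and passes to nonnegative [g]
    by monotone convergence, so infinite values are covered. *)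
Lemma weighted_measure (f : T -> R) : measurable_fun setT f ->
  (forall x, 0 <= f x)%R ->
  exists m : {measure set T -> \bar R},
    forall g : T -> \bar R, measurable_fun setT g -> (forall x, 0 <= g x) ->
      \int[m]_x g x = \int[mu]_x ((f x)%:E * g x).
Proof.
move=> mf f0.
have mEf : measurable_fun setT (EFin \o f) by exact/measurable_EFinP.
pose m S := \int[mu]_(x in S) (f x)%:E.
have m0 : m set0 = 0 by exact: integral_set0.
have mge0 S : 0 <= m S by apply: integral_ge0 => x _; rewrite lee_fin.
have msig : semi_sigma_additive m.
  move=> F mF tF mUF.
  rewrite /m ge0_integral_bigcup//; first last.
  - by move=> x _; rewrite lee_fin.
  - exact: measurable_funTS.
  by apply: is_cvg_nneseries => n _ _; exact: mge0.
pose M : {measure set T -> \bar R} :=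
  HB.pack m (isMeasure.Build d T R m m0 mge0 msig).
have ME S : M S = \int[mu]_(x in S) (f x)%:E by [].
exists M => g mg g0.
pose g_ := nnsfun_approx measurableT mg.
transitivity (limn (fun n => \int[M]_x (g_ n x)%:E)).
  rewrite -monotone_convergence//.
  - by apply: eq_integral => y _; apply/esym/cvg_lim => //; exact: cvg_nnsfun_approx.
  - by move=> n; exact/measurable_EFinP.
  - by move=> n y _; rewrite lee_fin.
  - by move=> y _ p n pn; rewrite lee_fin; exact/lefP/nd_nnsfun_approx.
rewrite (_ : (fun n => \int[M]_x (g_ n x)%:E) =
    (fun n => \int[mu]_x ((f x)%:E * (g_ n x)%:E))); last first.
  apply/funext => n.
  under eq_integral do rewrite fimfunE -fsumEFin//.
  rewrite ge0_integral_fsum//; last 2 first.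
  - by move=> y; exact/measurable_EFinP/measurable_funM.
  - by move=> y x _; rewrite nnfun_muleindic_ge0.
  transitivity (\sum_(k \in range (g_ n))
      \int[mu]_x ((f x)%:E * (k * \1_(g_ n @^-1` [set k]) x)%:E)).
    apply: eq_fsbigr => r /set_mem[z _ gz].
    have r0 : (0 <= r)%R by rewrite -gz.
    rewrite integralZl_indic_nnsfun// integral_indic// setIT ME.
    rewrite integral_mkcond.
    rewrite -ge0_integralZl//.
    + apply: eq_integral => x _; rewrite patchE indicE.
      by case: ifPn; rewrite ?mulr1 ?mulr0 ?mule0// muleC.
    + by apply/(measurable_restrictT _ _).1 => //; exact: measurable_funTS.
    + by move=> x _; apply: erestrict_ge0 => y _; rewrite lee_fin.
  rewrite -ge0_integral_fsum//.
  - apply: eq_integral => x _.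
    rewrite -(@ge0_mule_fsumr _ _ _ (fun k => (k * \1_(g_ n @^-1` [set k]) x)%:E)).
      by rewrite fsumEFin// -fimfunE.
    by move=> r; rewrite EFinM nnfun_muleindic_ge0.
  - move=> r; apply: emeasurable_funM => //.
    exact/measurable_EFinP/measurable_funM.
  - move=> r x _; apply: mule_ge0; first by rewrite lee_fin.
    by rewrite EFinM nnfun_muleindic_ge0.
rewrite -monotone_convergence//.
- apply: eq_integral => y _; apply/cvg_lim => //.
  apply: cvgeZl => //; exact: cvg_nnsfun_approx.
- by move=> n; apply: emeasurable_funM => //; exact/measurable_EFinP.
- by move=> n y _; rewrite mule_ge0// lee_fin.
- by move=> y _ p n pn; rewrite lee_wpmul2l ?lee_fin//; exact/lefP/nd_nnsfun_approx.
Qed.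

(** Law of [Z] under [mu] weighted by [f], characterized by its action on nonnegative functions. The
    distributional identities below become equalities of such measures. *)
Lemma weighted_law (f : T -> R) (Z : T -> T') : measurable_fun setT f ->
  (forall x, 0 <= f x)%R -> measurable_fun setT Z ->
  exists m : {measure set T' -> \bar R},
    forall g : T' -> \bar R, measurable_fun setT g -> (forall x, 0 <= g x) ->
      \int[m]_x g x = \int[mu]_x ((f x)%:E * g (Z x)).
Proof.
move=> mf f0 mZ; have [m mE] := weighted_measure mf f0.
pose Zm : {mfun T >-> T'} := HB.pack Z (isMeasurableFun.Build _ _ _ _ _ mZ).
pose M : {measure set T' -> \bar R} := pushforward m Zm.
exists (M mZ) => g mg g0.
rewrite (ge0_integral_pushforward mZ)// mE//=; last exact: measurableT_comp.
Qed.

End WeightedLaw.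
Section MeasurableElementary.
Context (d : measure_display) (T : measurableType d) (R : realType).
Implicit Types f g : T -> R.

Lemma measurable_cosf f : measurable_fun setT f ->
  measurable_fun setT (fun x => cos (f x)).
Proof.
by move=> mf; apply: measurableT_comp mf; apply: continuous_measurable_fun; exact: continuous_cos.
Qed.

Lemma measurable_sinf f : measurable_fun setT f ->
  measurable_fun setT (fun x => sin (f x)).
Proof.
by move=> mf; apply: measurableT_comp mf; apply: continuous_measurable_fun; exact: continuous_sin.
Qed.

Lemma measurable_expf f : measurable_fun setT f ->
  measurable_fun setT (fun x => expR (f x)).
Proof. by move=> mf; apply: measurableT_comp mf. Qed.

Lemma measurable_atanf f : measurable_fun setT f ->
  measurable_fun setT (fun x => atan (f x)).
Proof.
by move=> mf; apply: measurableT_comp mf; apply: continuous_measurable_fun => x; exact: continuous_atan.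
Qed.

Lemma measurable_invf f : measurable_fun setT f -> (forall x, 0 <= f x) ->
  measurable_fun setT (fun x => (f x)^-1).
Proof.
move=> mf f0; rewrite (_ : (fun x => _) = (fun x => powR (f x) (-1))).
  exact: (measurableT_comp (measurable_powR (-1)) mf).
by apply/funext => x; rewrite powR_inv1.
Qed.

Lemma measurable_addf f g : measurable_fun setT f -> measurable_fun setT g ->
  measurable_fun setT (fun x => f x + g x).
Proof. exact: measurable_funD. Qed.

Lemma measurable_mulf f g : measurable_fun setT f -> measurable_fun setT g ->
  measurable_fun setT (fun x => f x * g x).
Proof. exact: measurable_funM. Qed.

Lemma measurable_oppf f : measurable_fun setT f ->
  measurable_fun setT (fun x => - f x).
Proof. exact: measurable_funN. Qed.

Lemma measurable_expnf f n : measurable_fun setT f ->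
  measurable_fun setT (fun x => f x ^+ n).
Proof. exact: measurable_funX. Qed.

End MeasurableElementary.

Ltac mfun := repeat first
  [ exact: measurable_cst | exact: measurable_id | assumption
  | apply: measurable_addf | apply: measurable_mulf | apply: measurable_oppf
  | apply: measurable_expnf | apply: measurable_cosf | apply: measurable_sinf
  | apply: measurable_expf | apply: measurable_atanf ].

(** * Finite measures on the line are determined by their Fourier transforms *)

Section Poisson.
Context {R : realType}.
Implicit Types l u N z : R.

(** The Cauchy kernel of width [l], up to the factor [pi]. Smoothing with it, then letting [l] tend
    to 0, recovers masses of rays from Fourier transforms. *)
Let poisson l u := l / (l ^+ 2 + u ^+ 2).

(** Closed form of the integral of [expR (- (l * x)) * cos (x * u)] for [x] from 0 to [N]; it tends
    to [poisson l u] as [N] grows. *)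
Let laplace_cos l N u :=
  (expR (- (l * N)) * (u * sin (N * u) - l * cos (N * u)) + l) / (l ^+ 2 + u ^+ 2).

Let den_gt0 l u : 0 < l -> 0 < l ^+ 2 + u ^+ 2.
Proof. by move=> l0; rewrite ltr_wpDr ?sqr_ge0// exprn_gt0. Qed.

Let derive_laplace_cos l u N : 0 < l ->
  is_derive N 1 (fun N => laplace_cos l N u) (expR (- (l * N)) * cos (N * u)).
Proof.
move=> l0; rewrite /laplace_cos. derive.
have h := den_gt0 u l0. field; rewrite gt_eqF//.
Qed.

Let laplace_cos_poisson l N u : 0 < l ->
  `|poisson l u - laplace_cos l N u| <= expR (- (l * N)) * (2 / l).
Proof.
move=> l0; have h := den_gt0 u l0.
have -> : poisson l u - laplace_cos l N u =
    expR (- (l * N)) * ((l * cos (N * u) - u * sin (N * u)) / (l ^+ 2 + u ^+ 2)).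
  by rewrite /poisson /laplace_cos; field; rewrite gt_eqF//.
rewrite normrM ger0_norm ?expR_ge0// ler_wpM2l ?expR_ge0//.
rewrite normrM normfV (gtr0_norm h) ler_pdivrMr//.
apply: (@le_trans _ _ (l + `|u|)).
  apply: (le_trans (ler_normB _ _)); rewrite !normrM (gtr0_norm l0).
  by apply: lerD; [apply: ler_piMr (ltW l0) (cos_max _)|apply: ler_piMr (normr_ge0 _) (sin_max _)].
rewrite mulrAC ler_pdivlMr// -(real_normK (num_real u)).
have := sqr_ge0 (l - `|u|); have := sqr_ge0 (`|u|); nra.
Qed.

Let poisson_bound l u : 0 < l -> `|poisson l u| <= l^-1.
Proof.
move=> l0; have h := den_gt0 u l0.
rewrite /poisson ger0_norm; last exact: divr_ge0 (ltW l0) (ltW h).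
rewrite ler_pdivrMr// mulrC ler_pdivlMr//.
by rewrite -expr2 lerDl sqr_ge0.
Qed.

Let measurable_poisson l (d : measure_display) (T : measurableType d) (f : T -> R) :
  0 < l -> measurable_fun setT f ->
  measurable_fun setT (fun x => poisson l (f x)).
Proof.
move=> l0 mf; rewrite /poisson; mfun; apply: measurable_invf; first by mfun.
by move=> x; exact/ltW/den_gt0.
Qed.

Let measurable_laplace_cos l N (d : measure_display) (T : measurableType d) (f : T -> R) :
  0 < l -> measurable_fun setT f ->
  measurable_fun setT (fun x => laplace_cos l N (f x)).
Proof.
move=> l0 mf; rewrite /laplace_cos; mfun; apply: measurable_invf; first by mfun.
by move=> x; exact/ltW/den_gt0.
Qed.

Variables m1 m2 : {measure set R -> \bar R}.
Hypotheses (fin1 : (m1 setT < +oo)%E) (fin2 : (m2 setT < +oo)%E).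
Hypothesis cosE : forall r, \int[m1]_x cos (r * x) = \int[m2]_x cos (r * x).
Hypothesis sinE : forall r, \int[m1]_x sin (r * x) = \int[m2]_x sin (r * x).

(** By the addition formula, a shift [z] does not matter: the integral depends on the measure only
    through its Fourier transform at [r]. *)
Let Rintegral_cos_shift (m : {measure set R -> \bar R}) c r z :
  (m setT < +oo)%E ->
  \int[m]_x (c * cos (r * (z - x))) = c * (cos (r * z) * \int[m]_x cos (r * x)
    + sin (r * z) * \int[m]_x sin (r * x)).
Proof.
move=> fin.
have ic : m.-integrable setT (EFin \o (fun x => cos (r * x))).
  by apply: (bounded_integrable (C := 1)) => // [|x]; [mfun|exact: cos_max].
have isn : m.-integrable setT (EFin \o (fun x => sin (r * x))).
  by apply: (bounded_integrable (C := 1)) => // [|x]; [mfun|exact: sin_max].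
have izc := integrable_scalef (cos (r * z)) ic.
have izs := integrable_scalef (sin (r * z)) isn.
rewrite -!RintegralZl// -RintegralD// -RintegralZl//; last exact: integrable_addf.
by apply: eq_Rintegral => x _; rewrite mulrBr cosB.
Qed.

Let integrable_laplace_cos (m : {measure set R -> \bar R}) l N z :
  (m setT < +oo)%E -> 0 < l ->
  m.-integrable setT (EFin \o (fun x => laplace_cos l N (z - x))).
Proof.
move=> fin l0.
apply: (bounded_integrable (C := expR (- (l * N)) * (2 / l) + l^-1)) => //.
  by apply: measurable_laplace_cos => //; mfun.
move=> x; rewrite -[laplace_cos _ _ _](subKr (poisson l (z - x))).
rewrite (le_trans (ler_normB _ _))// addrC lerD ?poisson_bound//.
exact: laplace_cos_poisson.
Qed.

Let integrable_poisson (m : {measure set R -> \bar R}) l z :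
  (m setT < +oo)%E -> 0 < l ->
  m.-integrable setT (EFin \o (fun x => poisson l (z - x))).
Proof.
move=> fin l0; apply: (bounded_integrable (C := l^-1)) => //.
  by apply: measurable_poisson => //; mfun.
by move=> x; exact: poisson_bound.
Qed.

Let derive_int_laplace (m : {measure set R -> \bar R}) l z N :
  (m setT < +oo)%E -> 0 < l ->
  is_derive N 1 (fun N => \int[m]_x laplace_cos l N (z - x))
    (\int[m]_x (expR (- (l * N)) * cos (N * (z - x)))).
Proof.
move=> fin l0.
(* On the window [M > N - 1], so [expR (- (l * M))] is below the constant [expR (l * (1 - N))]. *)
refine (@is_derive_Rintegral _ _ R m (fun N x => laplace_cos l N (z - x))
  (fun N x => expR (- (l * N)) * cos (N * (z - x)))
  (fun=> expR (l * (1 - N))) N _ _ _ _).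
- by move=> M; exact: integrable_laplace_cos.
- by move=> M x; exact: derive_laplace_cos.
- by apply: (bounded_integrable (C := expR (l * (1 - N)))) => // x; rewrite ger0_norm// expR_ge0.
- move=> M x; rewrite ltr_norml => /andP[h _].
  rewrite normrM ger0_norm ?expR_ge0//; apply: (@le_trans _ _ (expR (- (l * M)))).
    by rewrite ler_piMr ?expR_ge0 ?cos_max.
  by rewrite ler_expR -mulrN ler_pM2l//; lra.
Qed.

(** The derivatives in [N] of both sides are determined by the Fourier transforms at [N], hence the
    difference is constant; at [N = 0] the kernel vanishes. Differentiating in [N] takes the place
    of exchanging two integrals. *)
Let eq_int_laplace l z N : 0 < l ->
  \int[m1]_x laplace_cos l N (z - x) = \int[m2]_x laplace_cos l N (z - x).
Proof.
move=> l0; apply/eqP; rewrite -subr_eq0; apply/eqP.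
pose D N := \int[m1]_x laplace_cos l N (z - x) - \int[m2]_x laplace_cos l N (z - x).
have D0 : D 0 = 0.
  have h (m : {measure set R -> \bar R}) : \int[m]_x laplace_cos l 0 (z - x) = 0.
    rewrite (@eq_Rintegral _ _ _ _ _ (fun=> 0)) ?Rintegral_cst ?mul0r// => x _.
    by rewrite /laplace_cos !mulr0 oppr0 mul0r expR0 sin0 cos0 mulr0 mulr1 sub0r mul1r addNr mul0r.
  by rewrite /D !h subr0.
rewrite -[LHS]/(D N) -D0; apply: derive0_eq => {}N.
have := derive_add (derive_int_laplace z N fin1 l0)
  (derive_opp (derive_int_laplace z N fin2 l0)).
by rewrite !Rintegral_cos_shift// cosE sinE subrr.
Qed.

(** Limit of [eq_int_laplace] for large [N], with an error of at most a constant times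
    [expR (- (l * N))]. *)
Let eq_int_poisson l z : 0 < l ->
  \int[m1]_x poisson l (z - x) = \int[m2]_x poisson l (z - x).
Proof.
move=> l0.
have approx (m : {measure set R -> \bar R}) N : (m setT < +oo)%E ->
    `|\int[m]_x poisson l (z - x) - \int[m]_x laplace_cos l N (z - x)| <=
    expR (- (l * N)) * (2 / l) * fine (m setT).
  move=> fin; rewrite -RintegralB//; [|exact: integrable_poisson|exact: integrable_laplace_cos].
  have iB := integrableB measurableT (integrable_poisson z fin l0)
    (integrable_laplace_cos N z fin l0).
  apply: (le_trans (le_normr_Rintegral measurableT iB)).
  rewrite -Rintegral_cst//; apply: le_Rintegral => //.
  - exact: integrable_norm.
  - apply: (bounded_integrable (C := `|expR (- (l * N)) * (2 / l)|)) => //.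
  - by move=> x _; exact: laplace_cos_poisson.
pose C := (2 / l) * (fine (m1 setT) + fine (m2 setT)).
have DC N : `|\int[m1]_x poisson l (z - x) - \int[m2]_x poisson l (z - x)| <=
    expR (- (l * N)) * C.
  have := approx m1 N fin1; have := approx m2 N fin2; rewrite (eq_int_laplace z N l0).
  rewrite /C; set a := (\int[_]_x _); set b := (\int[_]_x _); set c := (\int[_]_x _).
  move=> h1 h2; rewrite (_ : _ - _ = (c - b) - (a - b)); last by rewrite /a/b/c; ring.
  by rewrite (le_trans (ler_normB _ _))//; lra.
(* [expR (l * N)] is at least [1 + l * N], and this linear growth already excludes a positive
   difference. *)
have {}DC N : 0 <= N ->
    `|\int[m1]_x poisson l (z - x) - \int[m2]_x poisson l (z - x)| * (1 + l * N) <= C.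
  move=> N0; have := DC N; rewrite expRN mulrC ler_pdivlMr ?expR_gt0//.
  by apply: le_trans; rewrite ler_wpM2l// expR_ge1Dx.
apply/eqP; rewrite -subr_eq0 -normr_eq0; apply/negPn/negP => h.
have {}h : 0 < `|\int[m1]_x poisson l (z - x) - \int[m2]_x poisson l (z - x)|.
  by rewrite lt_neqAle eq_sym h normr_ge0.
move: h DC; set e := `|_| => e0 DC.
have C0 : 0 <= C by rewrite /C mulr_ge0 ?divr_ge0 ?addr_ge0 ?fine_ge0 ?(ltW l0).
(* At [N = C / (e * l)] the bound reads [e + C <= C]. *)
have := DC (C / (e * l)) (divr_ge0 C0 (ltW (mulr_gt0 e0 l0))).
rewrite (_ : e * _ = e + C); last by field; rewrite !gt_eqF.
lra.
Qed.

Let integrable_atan (m : {measure set R -> \bar R}) l z : (m setT < +oo)%E ->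
  m.-integrable setT (EFin \o (fun x => atan (l^-1 * (z - x)))).
Proof.
move=> fin; apply: (bounded_integrable (C := pi / 2)) => // [|x]; first by mfun.
by rewrite ler_norml (ltW (atan_gtNpi2 _)) (ltW (atan_ltpi2 _)).
Qed.

Let derive_int_atan (m : {measure set R -> \bar R}) l z :
  (m setT < +oo)%E -> 0 < l ->
  is_derive z 1 (fun z => \int[m]_x atan (l^-1 * (z - x)))
    (\int[m]_x poisson l (z - x)).
Proof.
move=> fin l0.
refine (@is_derive_Rintegral _ _ R m (fun z x => atan (l^-1 * (z - x)))
  (fun z x => poisson l (z - x)) (fun=> l^-1) z _ _ _ _).
- by move=> y; exact: integrable_atan.
- move=> y x; derive; have h := den_gt0 (y - x) l0; rewrite /poisson; field.
  rewrite (gt_eqF l0) (_ : _ + _ = l ^+ 2 + (y - x) ^+ 2); last by ring.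
  by rewrite gt_eqF.
- by apply: (bounded_integrable (C := `|l^-1|)).
- by move=> y x _; exact: poisson_bound.
Qed.

(** [atan (l^-1 * (z - x))] is a primitive in [z] of [poisson l (z - x)], so this is
    [eq_int_poisson] integrated for [z] from [a] to [b]. *)
Let eq_int_atan l a b : 0 < l ->
  \int[m1]_x (atan (l^-1 * (b - x)) - atan (l^-1 * (a - x))) =
  \int[m2]_x (atan (l^-1 * (b - x)) - atan (l^-1 * (a - x))).
Proof.
move=> l0; rewrite !RintegralB//; try exact: integrable_atan.
pose D z := \int[m1]_x atan (l^-1 * (z - x)) - \int[m2]_x atan (l^-1 * (z - x)).
suff : D a = D b by rewrite /D; lra.
apply: derive0_eq => z.
have := derive_add (derive_int_atan z fin1 l0) (derive_opp (derive_int_atan z fin2 l0)).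
by rewrite eq_int_poisson// subrr.
Qed.

Let cvg_atan_pihalf (u : nat -> R) C : (\forall n \near \oo, n%:R - C <= u n) ->
  (fun n => atan (u n)) @ \oo --> pi / 2.
Proof.
move=> uC; apply: cvg_comp (@cvgy_atan R).
apply/cvgryPge => M; near=> n; apply: (@le_trans _ _ (n%:R - C)); last by near: n.
rewrite lerBrDr; near: n; exact: nbhs_infty_ger.
Unshelve. all: by end_near. Qed.

Let eq_ray (b : R) : m1 `[b, +oo[%classic = m2 `[b, +oo[%classic.
Proof.
(* The width [1 / n.+1 ^ 2] is small compared with the offset [1 / n.+1] of the left end point in
   [F], so the limit at [x = b] is the full value [pi] and the closed ray is obtained. The right end
   point [n] goes to infinity. *)
pose l (n : nat) : R := (n.+1%:R ^+ 2)^-1.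
have l0 n : 0 < l n by rewrite invr_gt0 exprn_gt0.
have n1 n : n.+1%:R != 0 :> R by rewrite pnatr_eq0.
pose F n x := atan ((l n)^-1 * (n%:R - x)) - atan ((l n)^-1 * (b - n.+1%:R^-1 - x)).
pose f x : R := pi * \1_(`[b, +oo[%classic) x.
have Ff x : F ^~ x @ \oo --> f x.
  have h1 : (fun n => atan ((l n)^-1 * (n%:R - x))) @ \oo --> (pi / 2 : R).
    apply: (@cvg_atan_pihalf _ x); near=> n; rewrite /l invrK.
    have hx : x <= n%:R by near: n; exact: nbhs_infty_ger.
    by rewrite ler_peMl ?subr_ge0// -natrX ler1n expn_gt0.
  have [bx|xb] := leP b x.
    have -> : f x = pi / 2 - - (pi / 2).
      rewrite /f indicE mem_set/=; first by field.
      by rewrite in_itv/= bx.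
    apply: cvgB => //.
    rewrite (_ : (fun n => _) = (fun n => - atan (n.+1%:R + n.+1%:R ^+ 2 * (x - b)))).
      apply: cvgN; apply: (@cvg_atan_pihalf _ 0); apply: nearW => n.
      rewrite subr0; apply: ler_wpDr; last by rewrite ler_nat.
      by rewrite mulr_ge0 ?subr_ge0// sqr_ge0.
    apply/funext => n; rewrite -atanN /l invrK; congr atan.
    by move: n.+1%:R (n1 n) => k k0; field.
  have -> : f x = pi / 2 - pi / 2.
    rewrite /f indicE memNset/= ?mulr0 ?subrr//.
    by rewrite in_itv/= andbT; apply/negP; rewrite -ltNge.
  apply: cvgB => //; apply: (@cvg_atan_pihalf _ 0); near=> n.
  rewrite /l invrK subr0 (_ : _ * _ = n.+1%:R * (n.+1%:R * (b - x) - 1)); last first.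
    by move: n.+1%:R (n1 n) => k k0; field.
  apply: (@le_trans _ _ n.+1%:R); first by rewrite ler_nat.
  rewrite ler_peMr// lerBrDr -ler_pdivrMr ?subr_gt0//.
  apply: (@le_trans _ _ n%:R); last by rewrite ler_nat.
  near: n; exact: nbhs_infty_ger.
have F_le n x : `|F n x| <= pi.
  rewrite (le_trans (ler_normB _ _))// (splitr pi) lerD//.
    by rewrite ler_norml (ltW (atan_gtNpi2 _)) (ltW (atan_ltpi2 _)).
  by rewrite ler_norml (ltW (atan_gtNpi2 _)) (ltW (atan_ltpi2 _)).
have cvgF (m : {measure set R -> \bar R}) : (m setT < +oo)%E ->
    (fun n => \int[m]_x F n x) @ \oo --> pi * fine (m `[b, +oo[%classic).
  move=> fin.
  have -> : pi * fine (m `[b, +oo[%classic) = \int[m]_x f x.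
    rewrite RintegralZl//; last first.
      apply: (bounded_integrable (C := 1)) => // x.
      by rewrite ger0_norm indicE; case: (_ \in _).
    by rewrite /Rintegral integral_indic// setIT.
  apply: (dominated_cvg_Rintegral (g := fun=> pi)) => //.
  - by move=> n; rewrite /F; mfun.
  - by rewrite /f; mfun.
  - by apply: (bounded_integrable (C := `|pi|)).
have := cvgF m1 fin1.
rewrite (_ : (fun n => \int[m1]_x F n x) = (fun n => \int[m2]_x F n x)); last first.
  by apply/funext => n; exact: eq_int_atan.
move=> /cvg_unique/(_ (cvgF m2 fin2)) => /(_ (@norm_hausdorff _ _)) h.
have {}h := mulfI (lt0r_neq0 (pi_gt0 R)) h.
have fn (m : {measure set R -> \bar R}) : (m setT < +oo)%E -> m `[b, +oo[%classic \is a fin_num.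
  move=> fin; rewrite ge0_fin_numE//; apply: le_lt_trans fin.
  by rewrite le_measure ?inE.
by rewrite -(fineK (fn _ fin1)) h fineK// fn.
Unshelve. all: by end_near. Qed.

(** Closed rays form a generating class stable under intersection, and [eq_ray] compares the
    measures on it. *)
Theorem measure_cos_sin_unique S : measurable S -> m1 S = m2 S.
Proof.
move=> mS; apply: (@measure_unique _ R R (@RGenCInfty.G R) (fun n => `[- n%:R, +oo[%classic)) => //.
- exact: RGenCInfty.measurableE.
- move=> _ _ [x ->] [y ->]; exists (Num.max x y).
  apply/seteqP; split => z /=; rewrite !in_itv/= !andbT ge_max; last by move/andP.
  by move=> [-> ->].
- by move=> n; exists (- n%:R).
- rewrite -subTset => x _; exists (Num.bound `|x|) => //=.
  rewrite in_itv/= andbT lerNl (le_trans (ler_norm _))// normrN ltW//.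
  by rewrite archi_boundP.
- by move=> _ [x ->]; exact: eq_ray.
- by move=> n; apply: le_lt_trans fin1; rewrite le_measure ?inE.
Qed.

End Poisson.

(** * Real-valued integrals under weighted laws and products of probabilities *)

Section ProductIntegral.
Context (d d' : measure_display) (T : measurableType d) (T' : measurableType d').
Context (R : realType).

(** A bounded signed [g] is made nonnegative by adding [C]. The constant cancels afterwards because
    [m] is finite and its mass is the integral of [f]. *)
Lemma weighted_law_Rintegral (mu : {measure set T -> \bar R})
    (m : {measure set T' -> \bar R}) (f : T -> R) (Z : T -> T') :
  (forall x, 0 <= f x) -> mu.-integrable setT (EFin \o f) ->
  measurable_fun setT Z ->
  (forall g : T' -> \bar R, measurable_fun setT g -> (forall x, (0 <= g x)%E) ->
    (\int[m]_x g x = \int[mu]_x ((f x)%:E * g (Z x)))%E) ->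
  (m setT < +oo)%E /\
  forall (g : T' -> R) C, measurable_fun setT g -> (forall x, `|g x| <= C) ->
    \int[m]_x g x = \int[mu]_x (f x * g (Z x)).
Proof.
move=> f0 intf mZ mE; have mf := integrable_measurable intf.
have m1 : m setT = (\int[mu]_x (f x)%:E)%E.
  rewrite -[LHS]mul1e -(integral_cst m measurableT 1%E)/= mE//.
  by apply: eq_integral => x _; rewrite mule1.
have fin : (m setT < +oo)%E.
  by rewrite m1; case/integrableP: intf => _; under eq_integral do rewrite /= ger0_norm//.
split => // g C mg gC.
have gC0 x : 0 <= g x + C by have := gC x; rewrite ler_norml => /andP[? _]; lra.
have ig : m.-integrable setT (EFin \o g) by exact: (bounded_integrable fin mg gC).
have ifg : mu.-integrable setT (EFin \o (fun x => f x * g (Z x))).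
  apply: (ge0_le_integrable (g := fun x => C * f x)).
  - by apply: measurable_mulf => //; exact: measurableT_comp.
  - by move=> x; rewrite normrM (ger0_norm (f0 x)) mulrC ler_wpM2r.
  - exact: integrable_scalef.
have iC : m.-integrable setT (EFin \o (fun=> C)).
  by apply: (bounded_integrable (C := `|C|) fin).
have : \int[m]_x (g x + C) = \int[mu]_x (f x * g (Z x) + C * f x).
  congr fine; rewrite (mE (fun x => (g x + C)%:E)).
  - by apply: eq_integral => x _; rewrite -EFinM; congr EFin; ring.
  - by apply/measurable_EFinP; mfun.
  - by move=> x; rewrite lee_fin.
rewrite RintegralD// RintegralD//; last exact: integrable_scalef.
by rewrite Rintegral_cst// RintegralZl// m1 => /addIr.
Qed.

Variables (P : probability T R) (Q : probability T' R).

Lemma integrable_fst (h : T -> R) : P.-integrable setT (EFin \o h) ->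
  (P \x Q)%E.-integrable setT (EFin \o (fun z => h z.1)).
Proof.
move=> ih; have mh := integrable_measurable ih.
apply/integrable12ltyP; first by apply/measurable_EFinP; exact: measurableT_comp.
rewrite (_ : (\int[P]_x _)%E = (\int[P]_x `|(h x)%:E|)%E); first by case/integrableP: ih.
apply: eq_integral => x _; rewrite /= integral_cst//.
by rewrite [X in (_ * X)%E](probability_setT Q) mule1.
Qed.

Lemma Rintegral_prod (f : T * T' -> R) :
  (P \x Q)%E.-integrable setT (EFin \o f) ->
  (forall x, Q.-integrable setT (EFin \o (fun y => f (x, y)))) ->
  \int[(P \x Q)%E]_z f z = \int[P]_x \int[Q]_y f (x, y).
Proof.
move=> intf intQ; congr fine; rewrite -integral12_prod_meas1//.
by apply: eq_integral => x _; rewrite EFin_Rintegral.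
Qed.

Lemma product_probability_setT : (P \x Q)%E setT = 1%E.
Proof.
rewrite -setXTT product_measure1E// -[RHS]mule1.
by congr (_ * _)%E; exact: probability_setT.
Qed.

Lemma product_bounded_integrable (f : T * T' -> R) C : measurable_fun setT f ->
  (forall x, `|f x| <= C) -> (P \x Q)%E.-integrable setT (EFin \o f).
Proof.
have h : ((P \x Q)%E setT < +oo)%E by rewrite product_probability_setT ltry.
exact: bounded_integrable h.
Qed.

Lemma prob_bounded_integrable (f : T -> R) C : measurable_fun setT f ->
  (forall x, `|f x| <= C) -> P.-integrable setT (EFin \o f).
Proof.
have h : (P setT < +oo)%E by rewrite probability_setT ltry.
exact: bounded_integrable h.
Qed.

Lemma prob_Rintegral_cst (c : R) : \int[P]_x c = c.
Proof.
rewrite Rintegral_cst// -[RHS]mulr1; congr (_ * _).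
by rewrite -[RHS]/(fine 1%E); congr fine; exact: probability_setT.
Qed.

End ProductIntegral.

(** * The zero-bias identity from its Fourier form *)

Section ZeroBias.
Context (d d' : measure_display) (T : measurableType d) (T' : measurableType d').
Context (R : realType) (P : probability T R) (Q : probability T' R).
Variables (Z : T -> R) (U W : T' -> R) (V : R).
Hypotheses (mZ : measurable_fun setT Z) (mU : measurable_fun setT U)
  (mW : measurable_fun setT W).
Hypothesis intZ2 : P.-integrable setT (EFin \o (fun x => Z x ^+ 2)).
Hypothesis EZ2 : \int[P]_x (Z x ^+ 2) = V.

(** [cosE] and [sinE] are the zero-bias identity for trigonometric [g]. They are asked for [r != 0]
    only, since they will be obtained by dividing by [r]; at [r = 0] the masses agree by [EZ2]. *)
Hypothesis cosE : forall r, r != 0 ->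
  \int[P]_x (Z x ^+ 2 * \int[Q]_y cos (r * (U y * Z x))) =
  V * (\int[P]_x cos (r * Z x) * \int[Q]_y cos (r * W y) -
       \int[P]_x sin (r * Z x) * \int[Q]_y sin (r * W y)).
Hypothesis sinE : forall r, r != 0 ->
  \int[P]_x (Z x ^+ 2 * \int[Q]_y sin (r * (U y * Z x))) =
  V * (\int[P]_x sin (r * Z x) * \int[Q]_y cos (r * W y) +
       \int[P]_x cos (r * Z x) * \int[Q]_y sin (r * W y)).

Let V0 : 0 <= V. Proof. by rewrite -EZ2; apply: Rintegral_ge0 => x _; exact: sqr_ge0. Qed.

Let PQ := (P \x Q)%E.

Let PQ1 : PQ setT = 1%E. Proof. exact: product_probability_setT. Qed.

Let PQ_cst (c : R) : \int[PQ]_z c = c.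
Proof.
rewrite Rintegral_cst// -[RHS]mulr1; congr (_ * _).
by rewrite -[RHS]/(fine 1%E); congr fine; exact: PQ1.
Qed.

Let bPQ (f : T * T' -> R) C : measurable_fun setT f -> (forall x, `|f x| <= C) ->
  PQ.-integrable setT (EFin \o f).
Proof. exact: product_bounded_integrable. Qed.

Let mZ1 : measurable_fun setT (fun z : T * T' => Z z.1).
Proof. exact: measurableT_comp. Qed.
Let mU2 : measurable_fun setT (fun z : T * T' => U z.2).
Proof. exact: measurableT_comp. Qed.
Let mW2 : measurable_fun setT (fun z : T * T' => W z.2).
Proof. exact: measurableT_comp. Qed.

Let Rintegral_size_bias (g : R -> R) : measurable_fun setT g ->
  (forall x, `|g x| <= 1) ->
  \int[PQ]_z (Z z.1 ^+ 2 * g (U z.2 * Z z.1)) =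
  \int[P]_x (Z x ^+ 2 * \int[Q]_y g (U y * Z x)).
Proof.
move=> mg g1.
have mUz x : measurable_fun setT (fun y => g (U y * Z x)).
  by apply: measurableT_comp mg _; mfun.
have ig x : Q.-integrable setT (EFin \o (fun y => g (U y * Z x))).
  exact: (@prob_bounded_integrable _ _ _ Q _ 1).
rewrite Rintegral_prod.
- by apply: eq_Rintegral => x _; rewrite /= RintegralZl.
- apply: (ge0_le_integrable (g := fun z => Z z.1 ^+ 2)).
  + by apply: measurable_mulf; [mfun|apply: measurableT_comp mg _; mfun].
  + by move=> z; rewrite normrM normrX real_normK ?num_real// ler_piMr ?sqr_ge0.
  + exact: (integrable_fst Q intZ2).
- by move=> x; exact: (integrable_scalef (Z x ^+ 2) (ig x)).
Qed.

Let Rintegral_mul (f : T -> R) (g : T' -> R) :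
  measurable_fun setT f -> (forall x, `|f x| <= 1) ->
  measurable_fun setT g -> (forall x, `|g x| <= 1) ->
  PQ.-integrable setT (EFin \o (fun z => f z.1 * g z.2)) /\
  \int[PQ]_z (f z.1 * g z.2) = \int[P]_x f x * \int[Q]_y g y.
Proof.
move=> mf f1 mg g1.
have ig : Q.-integrable setT (EFin \o g) := @prob_bounded_integrable _ _ _ Q g 1 mg g1.
have if_ : P.-integrable setT (EFin \o f) := @prob_bounded_integrable _ _ _ P f 1 mf f1.
have iPQ : PQ.-integrable setT (EFin \o (fun z => f z.1 * g z.2)).
  apply: (@bPQ _ 1); first by apply: measurable_mulf; exact: measurableT_comp.
  by move=> z; rewrite normrM mulr_ile1.
split => //; rewrite Rintegral_prod//; last by move=> x; exact: (integrable_scalef (f x) ig).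
by under eq_Rintegral do rewrite /= RintegralZl//; rewrite RintegralZr.
Qed.

(** Each side integrates [g] against a finite measure: the law of [U Z] under [PQ] weighted by
    [Z ^+ 2], and the law of [Z + W] under [V] times [PQ]. Equal Fourier transforms make the
    measures equal, after which [g] may be unbounded. *)
Theorem zero_bias (g : R -> \bar R) : measurable_fun setT g ->
  (forall x, (0 <= g x)%E) ->
  (\int[P]_x \int[Q]_y ((Z x ^+ 2)%:E * g (U y * Z x)%R) =
   V%:E * \int[P]_x \int[Q]_y g (Z x + W y)%R)%E.
Proof.
move=> mg g0.
have mf1 : measurable_fun setT (fun z : T * T' => Z z.1 ^+ 2) by mfun.
have mh1 : measurable_fun setT (fun z : T * T' => U z.2 * Z z.1) by mfun.
have mh2 : measurable_fun setT (fun z : T * T' => Z z.1 + W z.2) by mfun.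
have [m1 m1E] := weighted_law PQ mf1 (fun z => sqr_ge0 (Z z.1)) mh1.
have mV : measurable_fun setT (fun z : T * T' => V) by [].
have [m2 m2E] := weighted_law PQ mV (fun=> V0) mh2.
have [fin1 R1] := weighted_law_Rintegral (fun z => sqr_ge0 (Z z.1))
  (integrable_fst Q intZ2) mh1 m1E.
have [fin2 R2] := weighted_law_Rintegral (fun=> V0)
  (@bPQ _ `|V| mV (fun=> lexx _)) mh2 m2E.
have mcos r : measurable_fun setT (fun x : R => cos (r * x)) by mfun.
have msin r : measurable_fun setT (fun x : R => sin (r * x)) by mfun.
have cos1 r x : `|cos (r * x)| <= 1 :> R by exact: cos_max.
have sin1 r x : `|sin (r * x)| <= 1 :> R by exact: sin_max.
have mcZ r : measurable_fun setT (fun x => cos (r * Z x)) by mfun.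
have msZ r : measurable_fun setT (fun x => sin (r * Z x)) by mfun.
have mcW r : measurable_fun setT (fun x => cos (r * W x)) by mfun.
have msW r : measurable_fun setT (fun x => sin (r * W x)) by mfun.
have eqm S : measurable S -> m1 S = m2 S.
  apply: measure_cos_sin_unique => // r.
  - rewrite (R1 _ 1)// (R2 _ 1)// [LHS](@Rintegral_size_bias (fun x => cos (r * x)))//.
    have [->|r0] := eqVneq r 0.
      under eq_Rintegral do under eq_Rintegral do rewrite mul0r cos0.
      under [RHS]eq_Rintegral do rewrite mul0r cos0 mulr1.
      under eq_Rintegral do rewrite prob_Rintegral_cst mulr1.
      by rewrite EZ2; apply/esym/PQ_cst.
    rewrite cosE//.
    have [i1 e1] := Rintegral_mul (mcZ r) (fun x => cos1 r (Z x)) (mcW r) (fun x => cos1 r (W x)).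
    have [i2 e2] := Rintegral_mul (msZ r) (fun x => sin1 r (Z x)) (msW r) (fun x => sin1 r (W x)).
    rewrite -e1 -e2 -RintegralB// -RintegralZl//; last exact: integrable_subf.
    by apply: eq_Rintegral => z _; rewrite [r * (_ + _)]mulrDr cosD.
  - rewrite (R1 _ 1)// (R2 _ 1)// [LHS](@Rintegral_size_bias (fun x => sin (r * x)))//.
    have [->|r0] := eqVneq r 0.
      under eq_Rintegral do under eq_Rintegral do rewrite mul0r sin0.
      under [RHS]eq_Rintegral do rewrite mul0r sin0 mulr0.
      under eq_Rintegral do rewrite prob_Rintegral_cst mulr0.
      by rewrite prob_Rintegral_cst; apply/esym/PQ_cst.
    rewrite sinE//.
    have [i1 e1] := Rintegral_mul (msZ r) (fun x => sin1 r (Z x)) (mcW r) (fun x => cos1 r (W x)).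
    have [i2 e2] := Rintegral_mul (mcZ r) (fun x => cos1 r (Z x)) (msW r) (fun x => sin1 r (W x)).
    rewrite -e1 -e2 -RintegralD// -RintegralZl//; last exact: integrable_addf.
    by apply: eq_Rintegral => z _; rewrite [r * (_ + _)]mulrDr sinD.
have : (\int[m1]_x g x = \int[m2]_x g x)%E.
  by apply: eq_measure_integral => S mS _; exact: eqm.
rewrite m1E// m2E// => h.
rewrite -(@fubini_tonelli1 _ _ _ _ _ P Q (fun z => (Z z.1 ^+ 2)%:E * g (U z.2 * Z z.1)%R)%E); last 2 first.
- apply: emeasurable_funM; first exact/measurable_EFinP.
  exact: measurableT_comp.
- by move=> z; rewrite mule_ge0// lee_fin sqr_ge0.
rewrite -(@fubini_tonelli1 _ _ _ _ _ P Q (fun z => g (Z z.1 + W z.2)%R)); last 2 first.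
- exact: measurableT_comp.
- by [].
rewrite h ge0_integralZl//; last exact: measurableT_comp.
Qed.

End ZeroBias.

(** * Taylor remainders of the exponential, divided by powers of the variable *)

Section ExponentialRemainders.
Context {R : realType}.
Implicit Types s y : R.

(** The integral of [expR (a * y)] for [a] from 0 to [s]; [exp_rem2 s y] is in turn the integral of
    [exp_rem1 a y]. The values at [y = 0] are the continuous extensions, and they carry the Gaussian
    part, which is the atom of Y at 0. *)
Definition exp_rem1 s y : R := if y == 0 then s else (expR (s * y) - 1) / y.

Definition exp_rem2 s y : R :=
  if y == 0 then s ^+ 2 / 2 else (expR (s * y) - 1 - s * y) / y ^+ 2.

Lemma exp_rem1_mul s y : y * exp_rem1 s y = expR (s * y) - 1.
Proof.
rewrite /exp_rem1; have [->|y0] := eqVneq y 0; last by field.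
by rewrite mulr0 expR0 subrr mul0r.
Qed.

Lemma exp_rem2_mul s y : y ^+ 2 * exp_rem2 s y = expR (s * y) - 1 - s * y.
Proof.
rewrite /exp_rem2; have [->|y0] := eqVneq y 0; last by field.
by rewrite mulr0 expR0 subrr subr0 expr0n mul0r.
Qed.

Lemma exp_rem1_0 y : exp_rem1 0 y = 0.
Proof.
by rewrite /exp_rem1; have [//|y0] := eqVneq y 0; rewrite mul0r expR0 subrr mul0r.
Qed.

Lemma exp_rem2_0 y : exp_rem2 0 y = 0.
Proof.
rewrite /exp_rem2; have [_|y0] := eqVneq y 0; first by rewrite expr0n mul0r.
by rewrite mul0r expR0 subrr subr0 mul0r.
Qed.

Lemma exp_rem1_ge0 s y : 0 <= s -> 0 <= exp_rem1 s y.
Proof.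
move=> s0; rewrite /exp_rem1; have [//|y0] := eqVneq y 0.
have [yn|yp] := ltP y 0.
  by rewrite nmulr_lge0 ?invr_lt0// subr_le0 -expR0 ler_expR mulr_ge0_le0// ltW.
by apply: divr_ge0 => //; rewrite subr_ge0 -expR0 ler_expR mulr_ge0.
Qed.

(* The secant slopes of [exp_rem2 ^~ y] lie between the end-point values of its
   derivative [exp_rem1 ^~ y]. *)
Lemma exp_rem2_secant a b y :
  (b - a) * exp_rem1 a y <= exp_rem2 b y - exp_rem2 a y <= (b - a) * exp_rem1 b y.
Proof.
rewrite /exp_rem1 /exp_rem2; have [_|y0] := eqVneq y 0.
  by have := sqr_ge0 (b - a); move=> h; apply/andP; split; nra.
have y2 : 0 < y ^+ 2 by rewrite exprn_even_gt0.
have -> : (expR (b * y) - 1 - b * y) / y ^+ 2 - (expR (a * y) - 1 - a * y) / y ^+ 2 =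
   (expR (b * y) - expR (a * y) - (b - a) * y) / y ^+ 2 by field.
(* Over the denominator [y ^+ 2] the bounds are compared without a case split on the sign of [y]. *)
have e z : (b - a) * ((z - 1) / y) = (b - a) * y * (z - 1) / y ^+ 2 by field.
rewrite !e !ler_pM2r ?invr_gt0//.
have h1 : expR (b * y) = expR (a * y) * expR ((b - a) * y) by rewrite -expRD; congr expR; ring.
have h2 : expR (a * y) = expR (b * y) * expR (- ((b - a) * y)) by rewrite -expRD; congr expR; ring.
have k1 := expR_ge1Dx ((b - a) * y).
have k2 := expR_ge1Dx (- ((b - a) * y)).
have p1 : expR (a * y) * (1 + (b - a) * y) <= expR (b * y).
  by rewrite h1 ler_wpM2l ?expR_ge0.
have p2 : expR (b * y) * (1 - (b - a) * y) <= expR (a * y).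
  by rewrite [leRHS]h2 ler_wpM2l ?expR_ge0.
apply/andP; split; lra.
Qed.

(** The two bounds of [exp_rem2_secant], compared with each other and divided by [b - a]. *)
Lemma exp_rem1_nd a b y : a <= b -> exp_rem1 a y <= exp_rem1 b y.
Proof.
rewrite le_eqVlt => /predU1P[->//|ab]; have /andP[h1 h2] := exp_rem2_secant a b y.
by have := le_trans h1 h2; rewrite ler_pM2l// subr_gt0.
Qed.

Lemma exp_rem2_nd a b y : 0 <= a -> a <= b -> exp_rem2 a y <= exp_rem2 b y.
Proof.
move=> a0 ab; have /andP[h1 _] := exp_rem2_secant a b y.
by rewrite -subr_ge0 (le_trans _ h1)// mulr_ge0 ?subr_ge0 ?exp_rem1_ge0.
Qed.

Lemma exp_rem2_ge0 s y : 0 <= s -> 0 <= exp_rem2 s y.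
Proof. by move=> s0; rewrite -(exp_rem2_0 y) exp_rem2_nd. Qed.

Lemma measurable_exp_rem1 d (T : measurableType d) (f : T -> R) s :
  measurable_fun setT f -> measurable_fun setT (fun x => exp_rem1 s (f x)).
Proof.
(* [1 / y] is written [y / y ^+ 2] because [measurable_invf] asks for a nonnegative function. *)
move=> mf; rewrite (_ : (fun x => _) = (fun x => if f x == 0 then s else
    (expR (s * f x) - 1) * f x * (f x ^+ 2)^-1)); last first.
  apply/funext => x; rewrite /exp_rem1; have [//|f0] := eqVneq (f x) 0.
  by field.
apply: measurable_fun_ifT; first exact: measurable_fun_eqr.
  by [].
by mfun; apply: measurable_invf => [|x]; [mfun|exact: sqr_ge0].
Qed.

Lemma measurable_exp_rem2 d (T : measurableType d) (f : T -> R) s :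
  measurable_fun setT f -> measurable_fun setT (fun x => exp_rem2 s (f x)).
Proof.
move=> mf; apply: measurable_fun_ifT; first exact: measurable_fun_eqr.
  by [].
by mfun; apply: measurable_invf => [|x]; [mfun|exact: sqr_ge0].
Qed.

End ExponentialRemainders.

(** * Secant bounds and left continuity of integrated remainders *)

Section RemainderIntegrals.
Local Open Scope ereal_scope.
Context (d : measure_display) (T : measurableType d) (R : realType).
Variables (mu : {measure set T -> \bar R}) (c X : T -> R).
Hypotheses (mc : measurable_fun setT c) (c0 : forall x, (0 <= c x)%R).
Hypothesis mX : measurable_fun setT X.

(** Used twice: with weight [Z ^+ 2] at the point [Z] for the moment generating function, and with
    constant weight [V] at the point [Y] for the cumulant. *)
Let F (s : R) := \int[mu]_x (c x * exp_rem2 s (X x))%:E.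
Let G (s : R) := \int[mu]_x (c x * exp_rem1 s (X x))%:E.

Let mF (s : R) : measurable_fun setT (fun x => (c x * exp_rem2 s (X x))%:E).
Proof.
by apply/measurable_EFinP/measurable_mulf => //; exact: measurable_exp_rem2.
Qed.

Let mG (s : R) : measurable_fun setT (fun x => (c x * exp_rem1 s (X x))%:E).
Proof.
by apply/measurable_EFinP/measurable_mulf => //; exact: measurable_exp_rem1.
Qed.

Let F0 (s : R) x : (0 <= s)%R -> 0 <= (c x * exp_rem2 s (X x))%:E.
Proof. by move=> s0; rewrite lee_fin mulr_ge0// exp_rem2_ge0. Qed.

Let G0 (s : R) x : (0 <= s)%R -> 0 <= (c x * exp_rem1 s (X x))%:E.
Proof. by move=> s0; rewrite lee_fin mulr_ge0// exp_rem1_ge0. Qed.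

Lemma int_exp_rem1_nd (a b : R) : (0 <= a)%R -> (a <= b)%R -> G a <= G b.
Proof.
move=> a0 ab; apply: ge0_le_integral => //.
- by move=> x _; exact: G0.
- by move=> x _; rewrite lee_fin ler_wpM2l// exp_rem1_nd.
Qed.

Lemma int_exp_rem2_nd (a b : R) : (0 <= a)%R -> (a <= b)%R -> F a <= F b.
Proof.
move=> a0 ab; apply: ge0_le_integral => //.
- by move=> x _; exact: F0.
- by move=> x _; rewrite lee_fin ler_wpM2l// exp_rem2_nd.
Qed.

(** Integrated half of [exp_rem2_secant], with no subtraction of integrals so that it keeps its
    meaning when they are infinite. *)
Lemma int_exp_rem2_lower (a b : R) : (0 <= a)%R -> (a <= b)%R ->
  F a + (b - a)%:E * G a <= F b.
Proof.
move=> a0 ab; rewrite -ge0_integralZl//; last 2 first.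
- by move=> x _; exact: G0.
- by rewrite lee_fin subr_ge0.
rewrite -ge0_integralD//; last 3 first.
- by move=> x _; exact: F0.
- by move=> x _; rewrite mule_ge0 ?G0// lee_fin subr_ge0.
- by apply: emeasurable_funM.
apply: ge0_le_integral => //.
- by move=> x _; rewrite adde_ge0 ?F0// mule_ge0 ?G0// lee_fin subr_ge0.
- by apply: emeasurable_funD => //; apply: emeasurable_funM.
- move=> x _; rewrite -EFinM -EFinD lee_fin mulrCA -mulrDr ler_wpM2l//.
  by have /andP[h _] := exp_rem2_secant a b (X x); rewrite addrC -lerBrDr.
Qed.

Lemma int_exp_rem2_upper (a b : R) : (0 <= a)%R -> (a <= b)%R ->
  F b <= F a + (b - a)%:E * G b.
Proof.
move=> a0 ab; have b0 := le_trans a0 ab; rewrite -ge0_integralZl//; last 2 first.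
- by move=> x _; exact: G0.
- by rewrite lee_fin subr_ge0.
rewrite -ge0_integralD//; last 3 first.
- by move=> x _; exact: F0.
- by move=> x _; rewrite mule_ge0 ?G0// lee_fin subr_ge0.
- by apply: emeasurable_funM.
apply: ge0_le_integral => //.
- by move=> x _; exact: F0.
- by apply: emeasurable_funD => //; apply: emeasurable_funM.
- move=> x _; rewrite -EFinM -EFinD lee_fin mulrCA -mulrDr ler_wpM2l//.
  by have /andP[_ h] := exp_rem2_secant a b (X x); rewrite addrC -lerBlDr.
Qed.

Lemma int_exp_rem2_0 : F 0%R = 0.
Proof. by rewrite /F; under eq_integral do rewrite exp_rem2_0 mulr0; rewrite integral0. Qed.

(** Monotone convergence along points increasing to [s], valid even if [F s] is infinite. This
    carries an identity known on [[0, s[] to the end point [s]. *)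
Lemma int_exp_rem2_left (s : R) : (0 <= s)%R ->
  (fun n => F (s * (1 - n.+1%:R^-1))%R) @ \oo --> F s.
Proof.
move=> s0.
have n0 n : (0 <= 1 - n.+1%:R^-1 :> R)%R.
  by rewrite subr_ge0 invf_le1// ler1n.
have u0 n : (0 <= s * (1 - n.+1%:R^-1))%R by rewrite mulr_ge0.
have us n : (s * (1 - n.+1%:R^-1) <= s)%R.
  by rewrite ler_piMr// lerBlDr lerDl invr_ge0.
pose f n x := (c x * exp_rem2 (s * (1 - n.+1%:R^-1)) (X x))%:E.
have -> : F s = \int[mu]_x limn (f ^~ x).
  apply: eq_integral => x _; apply/esym/cvg_lim => //.
  apply: cvg_EFin; first exact: nearW.
  apply: cvgMr.
  (* The secant bound with the slope taken at [s] controls the gap by a multiple of [1 / n.+1]. *)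
  have h n : (exp_rem2 s (X x) - s * exp_rem1 s (X x) * n.+1%:R^-1 <=
      exp_rem2 (s * (1 - n.+1%:R^-1)) (X x) <= exp_rem2 s (X x))%R.
    have /andP[_] := exp_rem2_secant (s * (1 - n.+1%:R^-1)) s (X x).
    rewrite (_ : (s - _) * _ = s * exp_rem1 s (X x) * n.+1%:R^-1)%R; last by ring.
    by move=> h; rewrite exp_rem2_nd// andbT lerBlDr addrC -lerBlDr.
  apply: (squeeze_cvgr _ _ (cvg_cst _)); first by apply: nearW => n; exact: h.
  have {2}-> : exp_rem2 s (X x) = (exp_rem2 s (X x) - s * exp_rem1 s (X x) * 0)%R.
    by rewrite mulr0 subr0.
  by apply: cvgB; [exact: cvg_cst|apply: cvgMr; exact: cvg_harmonic].
apply: (@cvg_monotone_convergence _ _ _ mu setT measurableT f) => //.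
- by move=> n; exact: mF.
- by move=> n x _; exact: F0.
- move=> x _ m n mn; rewrite lee_fin ler_wpM2l// exp_rem2_nd// ler_wpM2l//.
  by rewrite lerB// lef_pV2 ?posrE// ler_nat.
Qed.

End RemainderIntegrals.
(* [ln f] and [k] have slopes squeezed by [p / f] and [w], where [p = w * f] is
   monotone, so over a partition of mesh [s / N] they differ by at most
   [(s / N) * (p s - p 0)]. *)
Lemma ln_eq_of_secants (R : realType) (f p k w : R -> R) (S : R) :
  (forall a : R, 0 <= a < S -> 1 <= f a) ->
  (forall a : R, 0 <= a < S -> p a = w a * f a) ->
  (forall a : R, 0 <= a < S -> 0 <= p a) ->
  (forall a b : R, 0 <= a -> a <= b -> b < S -> p a <= p b) ->
  (forall a b : R, 0 <= a -> a <= b -> b < S ->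
    (b - a) * p a <= f b - f a <= (b - a) * p b) ->
  (forall a b : R, 0 <= a -> a <= b -> b < S ->
    (b - a) * w a <= k b - k a <= (b - a) * w b) ->
  f 0 = 1 -> k 0 = 0 ->
  forall s : R, 0 <= s < S -> ln (f s) = k s.
Proof.
move=> f1 pE p0 pnd fs ks f00 k0 s /andP[s0 sS].
pose D a := ln (f a) - k a.
have step (a b : R) : 0 <= a -> a <= b -> b < S -> `|D b - D a| <= (b - a) * (p b - p a).
  move=> a0 ab bS; have aS := le_lt_trans ab bS; have b0 := le_trans a0 ab.
  have fa1 : 1 <= f a by apply: f1; rewrite a0.
  have fb1 : 1 <= f b by apply: f1; rewrite b0.
  have pa : p a = w a * f a by apply: pE; rewrite a0.
  have pb : p b = w b * f b by apply: pE; rewrite b0.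
  have pab := pnd _ _ a0 ab bS.
  have /andP[fl fu] := fs _ _ a0 ab bS; have /andP[kl ku] := ks _ _ a0 ab bS.
  have fa0 : 0 < f a by lra.
  have fb0 : 0 < f b by lra.
  have ba0 : 0 <= b - a by rewrite subr_ge0.
  have lnD (x y : R) : 0 < x -> 0 < y -> ln y - ln x <= (y - x) / x.
    move=> x0 y0; rewrite -ln_div ?posrE//.
    have -> : y / x = 1 + (y - x) / x by field; rewrite gt_eqF.
    apply: le_ln1Dx; have h := divr_gt0 y0 x0.
    have -> : (y - x) / x = y / x - 1 by field; rewrite gt_eqF.
    by lra.
  have u1 := lnD _ _ fa0 fb0; have u2 := lnD _ _ fb0 fa0.
  (* By [p a = w a * f a] the left side is at most [(b - a) * (p b - p a) / f a], and [1 <= f a]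
     removes the denominator. In [v2] the same happens with [f b]. *)
  have v1 : (f b - f a) / f a - (b - a) * w a <= (b - a) * (p b - p a).
    rewrite -(ler_pM2r fa0) mulrBl divfK ?gt_eqF// -mulrA -pa.
    have q0 : 0 <= (b - a) * (p b - p a) by rewrite mulr_ge0 ?subr_ge0.
    apply: (@le_trans _ _ ((b - a) * (p b - p a))); first by rewrite mulrBr lerB.
    by rewrite ler_peMr.
  have v2 : (f a - f b) / f b + (b - a) * w b <= (b - a) * (p b - p a).
    rewrite -(ler_pM2r fb0) mulrDl divfK ?gt_eqF// -mulrA -pb.
    have q0 : 0 <= (b - a) * (p b - p a) by rewrite mulr_ge0 ?subr_ge0.
    apply: (@le_trans _ _ ((b - a) * (p b - p a))); last by rewrite ler_peMr.
    by rewrite mulrBr; lra.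
  by rewrite /D ler_norml; apply/andP; split; lra.
have bound (N : nat) : (0 < N)%N -> `|D s| * N%:R <= s * (p s - p 0).
  move=> N0; have N0' : 0 < N%:R :> R by rewrite ltr0n.
  pose x i : R := i%:R * s / N%:R.
  have xs i : (i <= N)%N -> 0 <= x i /\ x i <= s.
    move=> iN; split; first by rewrite /x divr_ge0 ?mulr_ge0.
    by rewrite /x ler_pdivrMr// mulrC ler_wpM2l// ler_nat.
  have ind i : (i <= N)%N -> `|D (x i)| <= s / N%:R * (p (x i) - p 0).
    elim: i => [_|i IH iN].
      by rewrite /x !mul0r subrr mulr0 /D f00 k0 ln1 subrr normr0.
    have {IH} IH := IH (ltnW iN).
    have [x0 _] := xs _ (ltnW iN); have [_ xS] := xs _ iN.
    have e : x i.+1 - x i = s / N%:R by rewrite /x -natr1; field; rewrite gt_eqF.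
    have xx : x i <= x i.+1 by rewrite -subr_ge0 e divr_ge0.
    have := step _ _ x0 xx (le_lt_trans xS sS); rewrite e => st.
    rewrite -[D (x i.+1)](subrK (D (x i))) (le_trans (ler_normD _ _))//.
    by lra.
  have := ind N (leqnn _); have -> : x N = s by rewrite /x mulrAC mulfV ?mul1r ?gt_eqF.
  by rewrite -ler_pdivlMr// mulrAC.
apply/eqP; rewrite -subr_eq0 -normr_eq0; apply/negPn/negP => D0.
have {}D0 : 0 < `|D s| by rewrite lt_neqAle eq_sym D0 normr_ge0.
pose q := s * (p s - p 0) / `|D s|.
have := bound (Num.bound q).+1 isT.
rewrite -ler_pdivlMl// mulrC -/q => h.
have q0 : 0 <= q by rewrite divr_ge0// mulr_ge0// subr_ge0 pnd.
have := archi_boundP q0; rewrite ltNge; move/negP; apply.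
by apply: le_trans h; rewrite ler_nat.
Qed.

(** Finiteness of [f] below [S] spreads to the other functions, so that [ln_eq_of_secants] applies:
    to [p] by a secant from [a] to a point strictly between [a] and [S], to [w] because [w <= p]
    when [f >= 1], and to [k] by a secant from 0. *)
Lemma expeR_of_secants (R : realType) (f r2 p k w : R -> \bar R) (S : R) :
  (forall s : R, 0 <= s -> (0 <= r2 s)%E) -> (forall s : R, 0 <= s -> (0 <= p s)%E) ->
  (forall s : R, 0 <= s -> (0 <= k s)%E) -> (forall s : R, 0 <= s -> (0 <= w s)%E) ->
  (forall s : R, 0 <= s -> (f s = 1 + r2 s)%E) ->
  (forall s : R, 0 <= s -> (p s = w s * f s)%E) ->
  (forall a b : R, 0 <= a -> a <= b -> (p a <= p b)%E) ->
  (forall a b : R, 0 <= a -> a <= b -> (r2 a + (b - a)%:E * p a <= r2 b)%E) ->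
  (forall a b : R, 0 <= a -> a <= b -> (r2 b <= r2 a + (b - a)%:E * p b)%E) ->
  (forall a b : R, 0 <= a -> a <= b -> (k a + (b - a)%:E * w a <= k b)%E) ->
  (forall a b : R, 0 <= a -> a <= b -> (k b <= k a + (b - a)%:E * w b)%E) ->
  r2 0 = 0%E -> k 0 = 0%E ->
  (forall a : R, 0 <= a < S -> (f a < +oo)%E) ->
  forall a : R, 0 <= a < S -> k a \is a fin_num /\ f a = (expR (fine (k a)))%:E.
Proof.
move=> r2_ge0 p_ge0 k_ge0 w_ge0 fE pE pnd rl ru kl ku r20 k0 fS.
have f_ge1 (s : R) : 0 <= s -> (1 <= f s)%E by move=> s0; rewrite fE// leeDl// r2_ge0.
have f_num (a : R) : (0 <= a < S)%R -> f a = (fine (f a))%:E.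
  move=> aS; have /andP[a0 _] := aS; rewrite fineK// ge0_fin_numE ?fS//.
  exact: le_trans lee01 (f_ge1 _ a0).
have r_num (a : R) : (0 <= a < S)%R -> r2 a = (fine (f a) - 1)%:E.
  move=> aS; have /andP[a0 _] := aS.
  have := f_num _ aS; have := r2_ge0 _ a0; rewrite fE//.
  by case: (r2 a) => [r| |]//= _ _; congr EFin; ring.
have p_num (a : R) : (0 <= a < S)%R -> p a = (fine (p a))%:E.
  move=> /andP[a0 aS]; rewrite fineK// ge0_fin_numE ?p_ge0//.
  pose b := ((a + S) / 2)%R.
  have ab : (a < b)%R by rewrite /b; lra.
  have bS : (0 <= b < S)%R by rewrite /b; apply/andP; split; lra.
  have := rl _ _ a0 (ltW ab); rewrite (r_num _ bS) => h.
  rewrite ltNge leye_eq; apply/negP => /eqP pinf; move: h.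
  rewrite pinf gt0_muley ?lte_fin ?subr_gt0// addey ?leye_eq//.
  by rewrite -ltNye (lt_le_trans _ (r2_ge0 _ a0)).
have w_num (a : R) : (0 <= a < S)%R -> w a = (fine (w a))%:E.
  move=> aS; have /andP[a0 _] := aS; rewrite fineK// ge0_fin_numE ?w_ge0//.
  apply: (@le_lt_trans _ _ (p a)); last by rewrite (p_num _ aS) ltry.
  by rewrite pE// -[leLHS]mule1 lee_wpmul2l ?w_ge0 ?f_ge1.
have k_num (a : R) : (0 <= a < S)%R -> k a = (fine (k a))%:E.
  move=> aS; have /andP[a0 _] := aS; rewrite fineK// ge0_fin_numE ?k_ge0//.
  apply: (le_lt_trans (ku _ _ (lexx 0%R) a0)).
  by rewrite k0 add0e (w_num _ aS) -EFinM ltry.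
have between (a b : R) : (0 <= a)%R -> (a <= b)%R -> (b < S)%R ->
    (0 <= a < S)%R /\ (0 <= b < S)%R.
  by move=> a0 ab bS; rewrite a0 (le_trans a0 ab) bS (le_lt_trans ab bS).
have f1 (a : R) : (0 <= a < S)%R -> (1 <= fine (f a))%R.
  by move=> aS; have /andP[a0 _] := aS; rewrite -lee_fin -f_num// f_ge1.
move=> a aS; split; first by rewrite (k_num _ aS).
rewrite (f_num _ aS).
have <- : ln (fine (f a)) = fine (k a).
  apply: (@ln_eq_of_secants R (fine \o f) (fine \o p) (fine \o k) (fine \o w) S) => //=.
  - move=> b bS; have /andP[b0 _] := bS; apply: EFin_inj.
    by rewrite EFinM -(p_num _ bS) -(w_num _ bS) -(f_num _ bS) pE.
  - by move=> b /andP[b0 _]; rewrite fine_ge0// p_ge0.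
  - move=> b c b0 bc cS; have [bS cS'] := between _ _ b0 bc cS.
    by have := pnd _ _ b0 bc; rewrite (p_num _ bS) (p_num _ cS').
  - move=> b c b0 bc cS; have [bS cS'] := between _ _ b0 bc cS.
    have := rl _ _ b0 bc; have := ru _ _ b0 bc.
    rewrite (p_num _ bS) (p_num _ cS').
    rewrite (r_num _ bS) (r_num _ cS') -!EFinM -!EFinD !lee_fin => h1 h2.
    by apply/andP; split; lra.
  - move=> b c b0 bc cS; have [bS cS'] := between _ _ b0 bc cS.
    have := kl _ _ b0 bc; have := ku _ _ b0 bc.
    rewrite (w_num _ bS) (w_num _ cS').
    rewrite (k_num _ bS) (k_num _ cS') -!EFinM -!EFinD !lee_fin => h1 h2.
    by apply/andP; split; lra.
  - by rewrite fE// r20 adde0.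
  - by rewrite k0.
by rewrite lnK// posrE (lt_le_trans ltr01)// f1.
Qed.

(** * The cumulant of a variable satisfying a zero-bias identity *)

Section MomentGeneratingFunction.
Local Open Scope ereal_scope.
Context (d d' : measure_display) (T : measurableType d) (T' : measurableType d').
Context (R : realType) (P : probability T R) (Q : probability T' R).
Variables (Z : T -> R) (U W Y : T' -> R) (V : R).
Hypotheses (mZ : measurable_fun setT Z) (mU : measurable_fun setT U)
  (mW : measurable_fun setT W) (mY : measurable_fun setT Y).
Hypotheses (intZ : P.-integrable setT (EFin \o Z)) (EZ : (\int[P]_x Z x = 0)%R).
Hypothesis V0 : (0 < V)%R.
Hypothesis U1 : forall y, (U y <= 1)%R.
Hypothesis bias : forall g : R -> \bar R, measurable_fun setT g ->
  (forall x, 0 <= g x) ->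
  \int[P]_x \int[Q]_y ((Z x ^+ 2)%:E * g (U y * Z x)%R) =
  V%:E * \int[P]_x \int[Q]_y g (Z x + W y)%R.
Hypothesis expU : forall s z : R, (0 < s)%R ->
  s%:E * \int[Q]_y (expR (s * (U y * z)))%:E = (exp_rem1 s z)%:E.
Hypothesis expW : forall s : R, (0 < s)%R ->
  s%:E * \int[Q]_y (expR (s * W y))%:E = \int[Q]_y (exp_rem1 s (Y y))%:E.

(** [p] stands for the derivative of [f]: [z ^+ 2 * exp_rem1 s z] is [z * (expR (s * z) - 1)], that
    is [z * expR (s * z)] made nonnegative by subtracting [z], whose mean is 0. In the same way [w]
    stands for the derivative of [k]. *)
Let f (s : R) := \int[P]_x (expR (s * Z x))%:E.
Let r2 (s : R) := \int[P]_x (Z x ^+ 2 * exp_rem2 s (Z x))%:E.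
Let p (s : R) := \int[P]_x (Z x ^+ 2 * exp_rem1 s (Z x))%:E.
Let k (s : R) := \int[Q]_y (V * exp_rem2 s (Y y))%:E.
Let w (s : R) := \int[Q]_y (V * exp_rem1 s (Y y))%:E.

Let mZ2 : measurable_fun setT (fun x => Z x ^+ 2)%R.
Proof. by mfun. Qed.
Let mV : measurable_fun setT (fun _ : T' => V).
Proof. by []. Qed.
Let Z20 x : (0 <= Z x ^+ 2)%R. Proof. exact: sqr_ge0. Qed.
Let V0' (y : T') : (0 <= V)%R. Proof. exact: ltW. Qed.

Let r2_ge0 (s : R) : (0 <= s)%R -> 0 <= r2 s.
Proof.
by move=> s0; apply: integral_ge0 => x _; rewrite lee_fin mulr_ge0// exp_rem2_ge0.
Qed.

Let k_ge0 (s : R) : (0 <= s)%R -> 0 <= k s.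
Proof.
by move=> s0; apply: integral_ge0 => x _; rewrite lee_fin mulr_ge0 ?(ltW V0)// exp_rem2_ge0.
Qed.

Let p_ge0 (s : R) : (0 <= s)%R -> 0 <= p s.
Proof.
by move=> s0; apply: integral_ge0 => x _; rewrite lee_fin mulr_ge0// exp_rem1_ge0.
Qed.

Let w_ge0 (s : R) : (0 <= s)%R -> 0 <= w s.
Proof.
by move=> s0; apply: integral_ge0 => x _; rewrite lee_fin mulr_ge0 ?(ltW V0)// exp_rem1_ge0.
Qed.

Let int_cst (a : R) : \int[P]_x a%:E = a%:E.
Proof.
by rewrite integral_cst//= -[RHS]mule1; congr (_ * _); exact: probability_setT.
Qed.

(** [expR (s * z)] is [1 + s * z + z ^+ 2 * exp_rem2 s z], and the linear term has mean 0. *)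
Let fE (s : R) : (0 <= s)%R -> f s = 1 + r2 s.
Proof.
move=> s0; have isZ := integrable_scalef s intZ.
have i1 : P.-integrable setT (EFin \o (fun=> 1%R)).
  by apply: (@prob_bounded_integrable _ _ _ P _ 1%R) => [|x]; [|rewrite normr1].
have i1Z := integrable_addf i1 isZ.
have ee x : expR (s * Z x) = (1 + s * Z x + Z x ^+ 2 * exp_rem2 s (Z x))%R.
  by rewrite exp_rem2_mul; ring.
have mr : measurable_fun setT (fun x => Z x ^+ 2 * exp_rem2 s (Z x))%R.
  by apply: measurable_mulf => //; exact: measurable_exp_rem2.
have r0 x : (0 <= Z x ^+ 2 * exp_rem2 s (Z x))%R by rewrite mulr_ge0// exp_rem2_ge0.
have e1Z : \int[P]_x (1 + s * Z x)%:E = 1.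
  rewrite -EFin_Rintegral// RintegralD// RintegralZl// EZ mulr0 addr0.
  by rewrite prob_Rintegral_cst.
have [fin|] := ltP (r2 s) +oo.
  have ir := integrable_ge0_lty mr r0 fin.
  rewrite /f /r2 -[in RHS]e1Z -integralD//.
  by apply: eq_integral => x _; rewrite ee.
(* When [r2 s] is infinite so is [f s]: otherwise the remainder would be a difference of integrable
   functions. *)
rewrite leye_eq => /eqP rinf; rewrite rinf addey//.
apply/eqP; rewrite -leye_eq leNgt; apply/negP => fin.
have ie : P.-integrable setT (EFin \o (fun x => expR (s * Z x))).
  by apply: integrable_ge0_lty fin => [|x]; [mfun|exact: expR_ge0].
have e : \int[P]_x (expR (s * Z x) - (1 + s * Z x))%:E = r2 s.
  by apply: eq_integral => x _; rewrite ee; congr EFin; ring.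
have := integrable_lty measurableT (integrable_subf ie i1Z).
by rewrite [X in X < _]e rinf ltxx.
Qed.

Let f_ge1 (s : R) : (0 <= s)%R -> 1 <= f s.
Proof. by move=> s0; rewrite fE// leeDl// r2_ge0. Qed.

(** [bias] for the exponential, multiplied by [s]: [expU] turns the left side into [p s], while on
    the right the exponential of the sum factors into [f s] and a term that [expW] identifies with
    [w s]. At [s = 0] both sides vanish. *)
Let pE (s : R) : (0 <= s)%R -> p s = w s * f s.
Proof.
rewrite le_eqVlt => /predU1P[<-|s0].
  rewrite /p /w; under eq_integral do rewrite exp_rem1_0 mulr0.
  by under [in RHS]eq_integral do rewrite exp_rem1_0 mulr0; rewrite !integral0 mul0e.
have s0' := ltW s0.
have mexp : measurable_fun setT (fun z : R => (expR (s * z))%:E).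
  by apply/measurable_EFinP; mfun.
have mexpU x : measurable_fun setT (fun y => (expR (s * (U y * Z x)))%:E).
  by apply/measurable_EFinP; mfun.
have mexpW : measurable_fun setT (fun y => (expR (s * W y))%:E).
  by apply/measurable_EFinP; mfun.
have expW0 : 0 <= \int[Q]_y (expR (s * W y))%:E.
  by apply: integral_ge0 => y _; rewrite lee_fin expR_ge0.
have e0 (z : R) : 0 <= (expR z)%:E by rewrite lee_fin expR_ge0.
have := bias mexp (fun x => e0 _).
rewrite (_ : \int[P]_x _ = \int[P]_x ((Z x ^+ 2)%:E * \int[Q]_y (expR (s * (U y * Z x)))%:E)); last first.
  by apply: eq_integral => x _; rewrite ge0_integralZl// lee_fin.
rewrite [in X in _ = X](_ : \int[P]_x _ = f s * \int[Q]_y (expR (s * W y))%:E); last first.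
  rewrite /f -ge0_integralZr//; last by apply/measurable_EFinP; mfun.
  apply: eq_integral => x _; rewrite -ge0_integralZl//.
  by apply: eq_integral => y _; rewrite -EFinM -expRD mulrDr.
move=> h.
have mI : measurable_fun setT (fun x => \int[Q]_y (expR (s * (U y * Z x)))%:E).
  apply: (@measurable_fun_fubini_tonelli_F _ _ _ _ _ Q
    (fun z => (expR (s * (U z.2 * Z z.1)))%:E)) => //.
  apply/measurable_EFinP.
  have m1 : measurable_fun setT (fun z : T * T' => U z.2) by exact: measurableT_comp.
  have m2 : measurable_fun setT (fun z : T * T' => Z z.1) by exact: measurableT_comp.
  by mfun.
transitivity (s%:E * \int[P]_x ((Z x ^+ 2)%:E * \int[Q]_y (expR (s * (U y * Z x)))%:E)).
  rewrite -ge0_integralZl//.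
  - by apply: eq_integral => x _; rewrite muleCA expU.
  - by apply: emeasurable_funM => //; exact/measurable_EFinP.
  - by move=> x _; rewrite mule_ge0 ?lee_fin// integral_ge0.
rewrite h; have -> : w s = V%:E * \int[Q]_y (exp_rem1 s (Y y))%:E.
  rewrite -ge0_integralZl// ?lee_fin ?ltW//.
  - by apply/measurable_EFinP; exact: measurable_exp_rem1.
  - by move=> y _; rewrite lee_fin exp_rem1_ge0.
rewrite -expW// -!muleA muleCA; congr (_ * _); congr (_ * _).
exact: muleC.
Qed.

(** Beyond the level [L], the factor [z ^+ 2] outweighs the loss from replacing [z] by [U z], with
    gain at least [a]. Below [L] the first term of the bound suffices. *)
Let trunc_exp_bound (s N L a z : R) : (0 < s)%R -> (0 < N)%R -> (0 < a)%R ->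
  (s * L = 1 + 2 * s ^+ 2 * a)%R ->
  (a * Num.min (expR (s * z)) N)%:E <= (a * expR (s * L))%:E +
    \int[Q]_y ((z ^+ 2)%:E * (Num.min (expR (s * (U y * z))) N)%:E).
Proof.
move=> s0 N0 a0 sL; have L0 : (0 < L)%R by rewrite -(pmulr_rgt0 _ s0) sL; nra.
have I0 : 0 <= \int[Q]_y ((z ^+ 2)%:E * (Num.min (expR (s * (U y * z))) N)%:E).
  apply: integral_ge0 => y _; rewrite mule_ge0// lee_fin ?sqr_ge0//.
  by rewrite le_min expR_ge0 ltW.
have [zL|Lz] := ltP z L.
  apply: (@le_trans _ _ (a * expR (s * L))%:E); last by rewrite leeDl.
  rewrite lee_fin ler_pM2l// (@le_trans _ _ (expR (s * z)))//.
    by rewrite ge_min lexx.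
  by rewrite ler_expR ler_pM2l// ltW.
have z0 := lt_le_trans L0 Lz.
(* The truncation is scaled out: [m * expR (s * x)] is below both [expR (s * x)] and [N] for every
   [x <= z], in particular for [x = U y * z]. *)
pose m := Num.min 1%R (N * expR (- (s * z)))%R.
have m0 : (0 <= m)%R by rewrite le_min ler01 mulr_ge0 ?expR_ge0 ?(ltW N0).
have gm : (Num.min (expR (s * z)) N = m * expR (s * z))%R.
  by rewrite /m minr_pMl ?expR_ge0// mul1r -mulrA -expRD addNr expR0 mulr1.
apply: (@le_trans _ _ (\int[Q]_y ((z ^+ 2)%:E * (Num.min (expR (s * (U y * z))) N)%:E))); last first.
  by rewrite leeDr// lee_fin mulr_ge0 ?expR_ge0 ?(ltW a0).
apply: (@le_trans _ _ (\int[Q]_y ((z ^+ 2 * m)%:E * (expR (s * (U y * z)))%:E))); last first.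
  apply: ge0_le_integral => //.
  - by move=> y _; rewrite mule_ge0// lee_fin ?expR_ge0// mulr_ge0// sqr_ge0.
  - by apply: emeasurable_funM => //; apply/measurable_EFinP; mfun.
  - apply: emeasurable_funM => //; apply/measurable_EFinP.
    by apply: measurable_minr => //; mfun.
  move=> y _; rewrite -!EFinM lee_fin -mulrA ler_wpM2l ?sqr_ge0// le_min; apply/andP; split.
    by rewrite ler_piMl ?expR_ge0// ge_min lexx.
  apply: (@le_trans _ _ (m * expR (s * z))%R).
    by rewrite ler_wpM2l// ler_expR ler_pM2l// ler_piMl ?(ltW z0).
  by rewrite -gm ge_min lexx orbT.
rewrite ge0_integralZl//; last 2 first.
- by apply/measurable_EFinP; mfun.
- by rewrite lee_fin mulr_ge0// sqr_ge0.
have -> : \int[Q]_y (expR (s * (U y * z)))%:E = (exp_rem1 s z / s)%:E.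
  have := expU z s0; set J := \int[Q]_y _ => h.
  by rewrite mulrC EFinM -h muleA -EFinM mulVf ?gt_eqF// mul1e.
rewrite -EFinM lee_fin gm.
have -> : (z ^+ 2 * m * (exp_rem1 s z / s) = m * (z / s * (z * exp_rem1 s z)))%R by field; rewrite gt_eqF.
rewrite exp_rem1_mul mulrCA ler_wpM2l//.
(* The value of [s * L] is chosen so that [z >= L] gives both [2 <= expR (s * z)] and
   [2 * a <= z / s]. The factor 2 in the latter pays for the [- 1] in [expR (s * z) - 1]. *)
have e2 : (2 <= expR (s * z))%R.
  apply: le_trans (expR_ge1Dx _); have : (s * L <= s * z)%R by rewrite ler_pM2l.
  by rewrite sL; nra.
have zs : (2 * a <= z / s)%R.
  rewrite ler_pdivlMr//; have : (s * L <= s * z)%R by rewrite ler_pM2l.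
  rewrite sL => h; have : (s * (2 * a * s) <= s * z)%R by lra.
  by rewrite ler_pM2l.
apply: (@le_trans _ _ (2 * a * (expR (s * z) - 1))%R).
  by have := mulr_ge0 (ltW a0) (ltW (expR_gt0 (s * z))); nra.
by rewrite ler_wpM2r//; lra.
Qed.

(** Absorption: the mean [Eg] of the truncated exponential satisfies [a * Eg <= a * expR (s * L) +
    (a / 2) * Eg], by [trunc_exp_bound] from one side and [bias] from the other. As [Eg] is finite,
    it is bounded independently of the truncation level [N]. *)
Let f_fin (s : R) : (0 < s)%R -> w s < +oo -> f s < +oo.
Proof.
move=> s0 wfin.
have om0 : 0 <= \int[Q]_y (expR (s * W y))%:E.
  by apply: integral_ge0 => y _; rewrite lee_fin expR_ge0.
have mexpW : measurable_fun setT (fun y => expR (s * W y)) by mfun.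
have wE : w s = V%:E * (s%:E * \int[Q]_y (expR (s * W y))%:E).
  rewrite expW// -ge0_integralZl// ?lee_fin ?(ltW V0)//.
  - by apply/measurable_EFinP; exact: measurable_exp_rem1.
  - by move=> y _; rewrite lee_fin exp_rem1_ge0 ?(ltW s0).
have omfin : \int[Q]_y (expR (s * W y))%:E \is a fin_num.
  rewrite ge0_fin_numE// ltNge leye_eq; apply/negP => /eqP h.
  by move: wfin; rewrite wE h !gt0_muley ?lte_fin// ltxx.
pose om := fine (\int[Q]_y (expR (s * W y))%:E).
have omE : \int[Q]_y (expR (s * W y))%:E = om%:E by rewrite fineK.
have om0' : (0 <= om)%R by rewrite fine_ge0.
(* Twice the constant [V * (1 + om)] of the upper bound [up], so that half of the left side absorbs
   the right one. *)
pose a := (2 * V * (1 + om))%R.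
have a0 : (0 < a)%R by rewrite /a !mulr_gt0//; lra.
pose L := ((1 + 2 * s ^+ 2 * a) / s)%R.
have sL : (s * L = 1 + 2 * s ^+ 2 * a)%R by rewrite /L mulrC divfK// gt_eqF.
pose g N z := Num.min (expR (s * z)) N.
have g0 N z : (0 < N)%R -> (0 <= g N z)%R by move=> N0; rewrite le_min expR_ge0 ltW.
have mg N : measurable_fun setT (g N) by apply: measurable_minr => //; mfun.
have mgZ N : measurable_fun setT (fun x => (g N (Z x))%:E).
  by apply/measurable_EFinP; exact: measurableT_comp.
have gbound (N : R) : (0 < N)%R -> \int[P]_x (g N (Z x))%:E <= (2 * expR (s * L))%:E.
  move=> N0.
  have igZ : P.-integrable setT (EFin \o (fun x => g N (Z x))).
    apply: (@prob_bounded_integrable _ _ _ P _ N); first exact: measurableT_comp.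
    by move=> x; rewrite ger0_norm ?g0// ge_min lexx orbT.
  have := EFin_Rintegral igZ; set Eg := (\int[P]_x _)%R => EgE.
  have gE0 x : 0 <= (g N x)%:E by rewrite lee_fin g0.
  pose I x := \int[Q]_y ((Z x ^+ 2)%:E * (g N (U y * Z x))%:E).
  have I0 x : 0 <= I x.
    by apply: integral_ge0 => y _; rewrite mule_ge0// lee_fin ?sqr_ge0.
  have mI : measurable_fun setT I.
    apply: (@measurable_fun_fubini_tonelli_F _ _ _ _ _ Q
      (fun z => (Z z.1 ^+ 2)%:E * (g N (U z.2 * Z z.1))%:E)) => [|z]; last first.
      by rewrite mule_ge0// lee_fin sqr_ge0.
    have m1 : measurable_fun setT (fun z : T * T' => U z.2) by exact: measurableT_comp.
    have m2 : measurable_fun setT (fun z : T * T' => Z z.1) by exact: measurableT_comp.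
    apply: emeasurable_funM; apply/measurable_EFinP; first by mfun.
    by apply: measurableT_comp (mg N) _; mfun.
  have up : \int[P]_x I x <= (V * (1 + om) * Eg)%:E.
    have := @bias (EFin \o g N) _ gE0 => ->; last exact/measurable_EFinP.
    rewrite -mulrA EFinM; apply: lee_wpmul2l; first by rewrite lee_fin ltW.
    rewrite EFinM EgE -ge0_integralZl// ?lee_fin; last by lra.
    apply: ge0_le_integral => //.
    - by move=> x _; apply: integral_ge0 => y _; exact: gE0.
    - apply: (@measurable_fun_fubini_tonelli_F _ _ _ _ _ Q
        (fun z => (g N (Z z.1 + W z.2))%:E)) => // .
      apply/measurable_EFinP; apply: measurableT_comp (mg N) _.
      by apply: measurable_addf; exact: measurableT_comp.
    - by apply: emeasurable_funM.
    move=> x _.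
    (* Pointwise [g N (z + w) <= g N z * (1 + expR (s * w))], whether or not [expR (s * z)] exceeds
       [N]; the added 1 serves the second case. *)
    apply: (@le_trans _ _ (\int[Q]_y ((g N (Z x))%:E * (1 + expR (s * W y))%:E))).
      apply: ge0_le_integral => //.
      + by move=> y _; exact: gE0.
      + by apply/measurable_EFinP; apply: measurableT_comp (mg N) _; mfun.
      + by apply: emeasurable_funM => //; apply/measurable_EFinP; mfun.
      move=> y _; rewrite -EFinM lee_fin /g (mulrDr s) expRD.
      have := expR_gt0 (s * Z x); have := expR_gt0 (s * W y).
      move: (expR _) (expR _) => c b b0 c0.
      have [cN|Nc] := leP c N; first by rewrite (@le_trans _ _ (c * b)%R)// ?ge_min ?lexx//; nra.
      by rewrite (@le_trans _ _ N)// ?ge_min ?lexx ?orbT//; nra.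
    rewrite ge0_integralZl// ?lee_fin ?g0//; last by apply/measurable_EFinP; mfun.
    rewrite muleC; apply: lee_wpmul2r => //.
    rewrite (_ : \int[Q]_y _ = \int[Q]_y (1 + (expR (s * W y))%:E)).
      rewrite ge0_integralD//.
      + rewrite omE integral_cst// EFinD mul1e.
        by apply: leeD => //; exact: probability_le1.
      + exact/measurable_EFinP.
    by apply: eq_integral => y _; rewrite EFinD.
  have lo : (a * Eg)%:E <= (a * expR (s * L))%:E + \int[P]_x I x.
    have -> : (a * Eg)%:E = \int[P]_x (a%:E * (g N (Z x))%:E).
      by rewrite ge0_integralZl// -?EgE// lee_fin ltW.
    have -> : (a * expR (s * L))%:E + \int[P]_x I x =
        \int[P]_x ((a * expR (s * L))%:E + I x).
      rewrite [RHS](@ge0_integralD _ _ _ P _ _ (fun=> (a * expR (s * L))%:E) I)//.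
      - by rewrite int_cst.
      - by move=> x _; rewrite lee_fin mulr_ge0 ?expR_ge0 ?(ltW a0).
    apply: ge0_le_integral => //.
    - by move=> x _; rewrite mule_ge0// lee_fin ltW.
    - exact: emeasurable_funM.
    - exact: emeasurable_funD.
    - by move=> x _; rewrite -EFinM; exact: trunc_exp_bound.
  have := le_trans lo (leeD2l _ up); rewrite -EFinD lee_fin -EgE lee_fin => h.
  have : (V * (1 + om) * Eg <= V * (1 + om) * (2 * expR (s * L)))%R.
    by move: h; rewrite /a; lra.
  by rewrite ler_pM2l// mulr_gt0//; lra.
apply: (@le_lt_trans _ _ (2 * expR (s * L))%:E); last exact: ltry.
pose G n x := (g n.+1%:R (Z x))%:E.
have -> : f s = \int[P]_x limn (G ^~ x).
  apply: eq_integral => x _; apply/esym/cvg_lim => //.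
  apply: cvg_near_cst; near=> n.
  rewrite /G /g min_l//.
  apply: (@le_trans _ _ n%:R%R); last by rewrite ler_nat.
  by near: n; exact: nbhs_infty_ger.
have mono x : {homo G ^~ x : i j / (i <= j)%N >-> i <= j}.
  move=> i j ij; rewrite lee_fin /g le_min !ge_min lexx/=.
  by rewrite ler_nat ltnS ij orbT.
have := @cvg_monotone_convergence _ _ _ P setT measurableT G
  (fun n => mgZ _) _ (fun x _ => mono x).
have G0 n x : setT x -> 0 <= G n x by move=> _; rewrite lee_fin g0.
by move=> /(_ G0); apply: cvge_le; apply: nearW => n; exact: gbound.
Unshelve. all: by end_near. Qed.

Let mgf_below (S : R) : (forall a : R, (0 <= a < S)%R -> f a < +oo) ->
  forall a : R, (0 <= a < S)%R ->
  k a \is a fin_num /\ f a = (expR (fine (k a)))%:E.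
Proof.
move=> fS; apply: (expeR_of_secants r2_ge0 p_ge0 k_ge0 w_ge0 fE pE) => //.
- by move=> a b; exact: int_exp_rem1_nd.
- by move=> a b; exact: int_exp_rem2_lower.
- by move=> a b; exact: int_exp_rem2_upper.
- by move=> a b; exact: int_exp_rem2_lower.
- by move=> a b; exact: int_exp_rem2_upper.
- by rewrite /r2; exact: int_exp_rem2_0.
- exact: int_exp_rem2_0.
Qed.

Theorem zero_bias_cumulant (s : R) : (0 <= s)%R ->
  lne (\int[P]_x (expR (s * Z x))%:E) = \int[Q]_y (V * exp_rem2 s (Y y))%:E.
Proof.
rewrite -/(f s) -/(k s) le_eqVlt => /predU1P[<-|s0].
  rewrite /f; under eq_integral do rewrite mul0r expR0.
  by rewrite int_cst lne1 /k int_exp_rem2_0.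
have s0' := ltW s0.
(* [mgf_below] reaches only points strictly below [s]; the [u n] increase to [s], where [f] and [k]
   are left continuous. *)
pose u n : R := (s * (1 - n.+1%:R^-1))%R.
have uS n : (0 <= u n < s)%R.
  rewrite /u mulr_ge0//=; last by rewrite subr_ge0 invf_le1// ler1n.
  by rewrite gtr_pMr// gtrDl oppr_lt0 invr_gt0.
have fcvg : (f \o u) n @[n --> \oo] --> f s.
  rewrite fE// (_ : f \o u = fun n => 1 + r2 (u n)); last first.
    by apply/funext => n /=; rewrite fE//; have /andP[] := uS n.
  apply: cvgeD; first by rewrite ge0_adde_def// inE ?lee01// r2_ge0.
    exact: cvg_cst.
  exact: int_exp_rem2_left.
have kcvg : (k \o u) n @[n --> \oo] --> k s by exact: int_exp_rem2_left.
have [fs|] := ltP (f s) +oo.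
  have fa a : (0 <= a < s)%R -> f a < +oo.
    move=> /andP[a0 /ltW aS]; apply: le_lt_trans fs.
    by rewrite !fE// leeD2l// int_exp_rem2_nd.
  have fnum : f s \is a fin_num.
    by rewrite ge0_fin_numE// (le_trans lee01)// f_ge1.
  have fpos : (0 < fine (f s))%R.
    by rewrite (lt_le_trans ltr01)// -lee_fin fineK// f_ge1.
  rewrite -(fineK fnum) lne_EFin//.
  apply: (cvg_unique _ _ kcvg) => //.
  rewrite (_ : k \o u = EFin \o (@ln R \o (fine \o (f \o u)))); last first.
    apply/funext => n /=; have [kf ->] := mgf_below fa (uS n).
    by rewrite /= expRK fineK.
  apply: cvg_EFin; first exact: nearW.
  apply: (cvg_comp (fine \o (f \o u)) (@ln R)).
    have h : (f \o u) n @[n --> \oo] --> (fine (f s))%:E by rewrite fineK.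
    exact: fine_cvg h.
  exact: (continuous_ln fpos).
(* If [f s] is infinite and [k s] is not, the secant bound keeps [w] finite on [[0, s[], hence also
   [f] by [f_fin]. There [f] stays below [expR (fine (k s))], which contradicts left continuity at
   [s]. *)
rewrite leye_eq => /eqP fs; rewrite fs /=.
apply/esym/eqP; rewrite -leye_eq leNgt; apply/negP => ks.
have fa a : (0 <= a < s)%R -> f a < +oo.
  move=> /andP[]; rewrite le_eqVlt => /predU1P[<- _|a0 aS].
    by rewrite /f; under eq_integral do rewrite mul0r expR0; rewrite int_cst ltry.
  apply: f_fin => //; rewrite ltNge leye_eq; apply/negP => /eqP winf.
  have := int_exp_rem2_lower Q mV V0' mY (ltW a0) (ltW aS).
  rewrite -/(w a) -/(k a) -/(k s) winf gt0_muley ?lte_fin ?subr_gt0//.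
  rewrite addey; last by rewrite -ltNye (lt_le_trans _ (k_ge0 (ltW a0))).
  by rewrite leye_eq => /eqP h; rewrite h ltxx in ks.
have knum : k s \is a fin_num by rewrite ge0_fin_numE// k_ge0.
have : +oo <= (expR (fine (k s)))%:E.
  rewrite -fs; apply: cvge_le fcvg; apply: nearW => n /=.
  have [kf ->] := mgf_below fa (uS n); rewrite lee_fin ler_expR.
  have /andP[u0 /ltW us] := uS n.
  by rewrite fine_le// int_exp_rem2_nd.
by rewrite leye_eq.
Qed.

End MomentGeneratingFunction.

(** * Expectations under the Beta(1,2) law *)

Section BetaLaw.
Context (d : measure_display) (T : measurableType d) (R : realType).
Context (Q : probability T R) (B : {RV Q >-> R}).
Hypothesis hB : beta12_law B.

(** The fundamental theorem of calculus on the unit interval, for a primitive [G] of the density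
    times [g] supplied by the caller. *)
Lemma beta12_expectation (g G : R -> R) : (forall b, 0 <= g b) -> continuous g ->
  (forall b : R, is_derive b 1 G (2 * (1 - b) * g b)) ->
  (\int[Q]_w (g (B w))%:E = (G 1 - G 0)%:E)%E.
Proof.
move=> g0 cg dG.
pose f (b : R) : R := 2 * (1 - b) * \1_(`]0%R, 1%R[%classic) b.
have mg : measurable_fun setT g by exact: continuous_measurable_fun.
have mf : measurable_fun setT f by rewrite /f; mfun.
have f0 b : 0 <= f b.
  rewrite /f indicE; case: (boolP (b \in _)) => [|_]; last by rewrite mulr0.
  rewrite inE/= in_itv/= => /andP[_ b1]; rewrite mulr1; lra.
have [m mE] := weighted_law lebesgue_measure mf f0 (@measurable_id _ R setT).
have mB S : measurable S -> distribution Q B S = m S.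
  move=> mS; have -> : m S = (\int[m]_x (\1_S x)%:E)%E by rewrite integral_indic// setIT.
  rewrite hB// mE//; last by apply/measurable_EFinP.
  rewrite [LHS]integral_mkcond; apply: eq_integral => x _; rewrite patchE [\1_S _]indicE.
  have [xS|xS] := pselect (S x); first by rewrite !mem_set// mule1.
  by rewrite !memNset// mule0.
rewrite -(@ge0_integral_distribution _ _ _ _ _ Q B (EFin \o g))//; last exact/measurable_EFinP.
rewrite (eq_measure_integral m); last by move=> S mS _; exact: mB.
rewrite mE//; last exact/measurable_EFinP.
rewrite (_ : (\int[_]_x _)%E = (\int[lebesgue_measure]_(x in `]0%R, 1%R[) (2 * (1 - x) * g x)%:E)%E); last first.
  rewrite [RHS]integral_mkcond; apply: eq_integral => x _.
  rewrite patchE /f indicE.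
  have [xS|xS] := pselect (`]0%R, 1%R[%classic x); first by rewrite !mem_set// mulr1.
  by rewrite !memNset// mulr0 mul0e.
have cf : continuous (fun x : R => 2 * (1 - x) * g x).
  have c1 : continuous (fun x : R => 2 * (1 - x)).
    by apply: (is_derive_continuous (df := fun=> - 2)) => y; derive; ring.
  by move=> x; exact: (cvgM (c1 x) (cg x)).
have cG := is_derive_continuous dG.
have mfg : measurable_fun setT (fun x : R => (2 * (1 - x) * g x)%:E).
  by apply/measurable_EFinP; exact: continuous_measurable_fun.
rewrite integral_itv_obnd_cbnd; last exact: measurable_funTS.
rewrite integral_itv_bndo_bndc; last exact: measurable_funTS.
rewrite (@continuous_FTC2 R _ G 0 1)//.
- by apply: continuous_subspaceT.
- split.
  + by move=> x _; have [] := dG x.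
  + by apply: cvg_at_right_filter; exact: cG.
  + by apply: cvg_at_left_filter; exact: cG.
- by move=> x _; rewrite derive1E; have [_ ->] := dG x.
Qed.

End BetaLaw.

(** * Independence as a product law *)

Section JointLaw.
Context (d : measure_display) (T : measurableType d) (R : realType).
Context (Q : probability T R) (B Y : {RV Q >-> R}).
Hypothesis hBY : independent_pair B Y.

(** The law of the pair agrees with the product of its marginals on rectangles, hence everywhere.
    Tonelli then averages over [B] first, with the value of [Y] frozen. *)
Lemma independent_ge0_integral (F : R * R -> \bar R) : measurable_fun setT F ->
  (forall z, (0 <= F z)%E) ->
  (\int[Q]_w F (B w, Y w) = \int[Q]_y \int[Q]_b F (B b, Y y))%E.
Proof.
move=> mF F0.
have mBY : measurable_fun setT (fun w => (B w, Y w)) by exact: measurable_fun_pair.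
have m1 : measurable_fun setT (fun _ : T => 1 : R) by [].
have [m mE] := weighted_law Q m1 (fun=> ler01) mBY.
have mS S : measurable S -> m S = Q ((fun w => (B w, Y w)) @^-1` S).
  move=> mS; rewrite -[in LHS](setIT S) -integral_indic// mE//.
  - under eq_integral do rewrite mul1e.
    rewrite -[in RHS](setIT ((fun w => (B w, Y w)) @^-1` S)) -integral_indic//.
    by rewrite -[X in measurable X]setTI; exact: mBY.
  - exact/measurable_EFinP.
transitivity (\int[m]_z F z)%E.
  by rewrite mE//; apply: eq_integral => w _; rewrite mul1e.
transitivity (\int[distribution Q B \x distribution Q Y]_z F z)%E.
  apply: eq_measure_integral => S mS' _; apply/esym/product_measure_unique => //.
  by move=> S1 S2 h1 h2; rewrite mS; [exact: hBY|exact: measurableX].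
rewrite fubini_tonelli2//.
rewrite ge0_integral_distribution//.
- apply: eq_integral => y _ /=.
  rewrite /fubini_G ge0_integral_distribution//.
  by apply: measurableT_comp mF _; exact: measurable_fun_pair.
- exact: measurable_fun_fubini_tonelli_G.
- by move=> y; apply: integral_ge0.
Qed.

Lemma independent_Rintegral (F : R * R -> R) C : measurable_fun setT F ->
  (forall z, `|F z| <= C) ->
  \int[Q]_w F (B w, Y w) = \int[Q]_y \int[Q]_b F (B b, Y y).
Proof.
move=> mF FC.
have FC0 z : 0 <= F z + C by have := FC z; rewrite ler_norml => /andP[? _]; lra.
have mB y : measurable_fun setT (fun b => F (B b, y)).
  by apply: measurableT_comp mF _; exact: measurable_fun_pair.
have iB y : Q.-integrable setT (EFin \o (fun b => F (B b, y))).
  exact: (@prob_bounded_integrable _ _ _ Q _ C).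
have iBY : Q.-integrable setT (EFin \o (fun w => F (B w, Y w))).
  apply: (@prob_bounded_integrable _ _ _ Q _ C) => //.
  by apply: measurableT_comp mF _; exact: measurable_fun_pair.
have iC : Q.-integrable setT (EFin \o (fun=> C)).
  by apply: (@prob_bounded_integrable _ _ _ Q _ `|C|).
have IC y : \int[Q]_b (F (B b, y) + C) = \int[Q]_b F (B b, y) + C.
  by rewrite RintegralD// prob_Rintegral_cst.
have intB : Q.-integrable setT (EFin \o (fun y => \int[Q]_b F (B b, Y y))).
  have m2 : measurable_fun setT (fun z : T * T => F (B z.2, Y z.1)).
    apply: measurableT_comp mF _; apply: measurable_fun_pair.
      by apply: measurableT_comp => //; exact: measurable_snd.
    by apply: measurableT_comp => //; exact: measurable_fst.
  have i2 := @product_bounded_integrable _ _ _ _ _ Q Q _ C m2 (fun z => FC _).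
  apply: eq_integrable (integrable_fubini_F i2) => // y _.
  by rewrite /fubini_F /= EFin_Rintegral.
have : \int[Q]_w (F (B w, Y w) + C) = \int[Q]_y (\int[Q]_b F (B b, Y y) + C).
  congr fine; rewrite (independent_ge0_integral (F := fun z => (F z + C)%:E)).
  - by apply: eq_integral => y _; rewrite -IC EFin_Rintegral//; exact: integrable_addf.
  - by apply/measurable_EFinP; mfun.
  - by move=> z; rewrite lee_fin.
by rewrite !RintegralD// prob_Rintegral_cst => /addIr.
Qed.

End JointLaw.
Lemma weighted_law_measure (d d' : measure_display) (T : measurableType d)
    (T' : measurableType d') (R : realType) (mu : {measure set T -> \bar R})
    (m : {measure set T' -> \bar R}) (f : T -> R) (Z : T -> T') :
  (forall g : T' -> \bar R, measurable_fun setT g -> (forall x, (0 <= g x)%E) ->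
    (\int[m]_x g x = \int[mu]_x ((f x)%:E * g (Z x)))%E) ->
  measurable_fun setT Z ->
  forall S, measurable S -> m S = (\int[mu]_(x in Z @^-1` S) (f x)%:E)%E.
Proof.
move=> mE mZ S mS.
have -> : m S = (\int[m]_x (\1_S x)%:E)%E by rewrite integral_indic// setIT.
rewrite mE//; last exact/measurable_EFinP.
rewrite [RHS]integral_mkcond; apply: eq_integral => x _; rewrite patchE indicE.
have [xS|xS] := pselect (S (Z x)); first by rewrite !mem_set// mule1.
by rewrite !memNset// mule0.
Qed.

(** * Averages over Y as Gaussian and jump contributions *)

Section DirectionalLaw.
Context (d d' : measure_display) (T : measurableType d) (T' : measurableType d').
Context (R : realType) (nu : {measure set T -> \bar R}) (u : T -> R).
Context (Q : probability T' R) (Y : {RV Q >-> R}) (v V : R).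
Hypotheses (mu : measurable_fun setT u) (v0 : 0 <= v) (V0 : 0 < V).
Hypothesis hY : forall S : set R, measurable S ->
  distribution Q Y S = ((v%:E * \d_(0%R : R) S +
    \int[nu]_(x in [set x | S (u x)]) (u x ^+ 2)%:E) * (V^-1)%:E)%E.

(** [hY] says that [V] times the law of [Y] is [v] times the Dirac mass at 0 plus the image under
    [u] of [nu] weighted by [u ^+ 2]; each of the three is built by [weighted_law]. *)
Lemma directional_ge0_integral (g : R -> \bar R) : measurable_fun setT g ->
  (forall x, (0 <= g x)%E) ->
  (V%:E * \int[Q]_w g (Y w) = v%:E * g 0%R + \int[nu]_x ((u x ^+ 2)%:E * g (u x)))%E.
Proof.
move=> mg g0.
have mu2 : measurable_fun setT (fun x => u x ^+ 2) by mfun.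
have mY : measurable_fun setT Y by [].
have mid : measurable_fun setT (fun x : R => x) by [].
have [m1 m1E] := weighted_law nu mu2 (fun x => sqr_ge0 (u x)) mu.
have [m2 m2E] := weighted_law (\d_(0%R : R) : {measure set R -> \bar R})
  (measurable_cst v) (fun=> v0) mid.
have [m3 m3E] := weighted_law Q (measurable_cst V) (fun=> ltW V0) mY.
have eqm S : measurable S -> m3 S = measure_add m2 m1 S.
  move=> mS; rewrite measure_addE.
  have mYS : measurable (Y @^-1` S) by rewrite -[X in measurable X]setTI; exact: mY.
  have -> : m3 S = (V%:E * Q (Y @^-1` S))%E.
    by rewrite (weighted_law_measure m3E mY mS) -integral_cst.
  have -> : m2 S = (v%:E * \d_(0%R : R) S)%E.
    by rewrite (weighted_law_measure m2E mid mS) -integral_cst.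
  rewrite (weighted_law_measure m1E mu mS).
  have := hY mS; rewrite /distribution/= /pushforward => ->.
  by rewrite muleCA -[X in (_ * X)%E]EFinM mulfV ?gt_eqF// mule1.
transitivity (\int[m3]_x g x)%E.
  rewrite m3E//= ge0_integralZl//; last by rewrite lee_fin ltW.
  exact: measurableT_comp.
rewrite (eq_measure_integral (measure_add m2 m1)); last by move=> S mS _; exact: eqm.
rewrite ge0_integral_measure_add// m1E// m2E//; congr (_ + _)%E.
rewrite integral_dirac//; first by rewrite diracT mul1e.
by apply: emeasurable_funM => //; exact/measurable_EFinP.
Qed.

(** The law of [Y] tested on the constant 1: since its mass is 1, the second moment of [nu] along
    [u] is finite and completes [v] to [V]. *)
Lemma directional_variance :
  nu.-integrable setT (EFin \o (fun x => u x ^+ 2)) /\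
  v + \int[nu]_x (u x ^+ 2) = V.
Proof.
have := directional_ge0_integral (measurable_cst 1%E) (fun=> lee01).
have -> : (\int[Q]_w cst 1 (Y w) = 1)%E.
  by rewrite integral_cst// mul1e; exact: probability_setT.
rewrite !mule1.
have -> : (\int[nu]_x ((u x ^+ 2)%:E * cst 1 (u x)) = \int[nu]_x (u x ^+ 2)%:E)%E.
  by apply: eq_integral => x _; rewrite mule1.
move=> h.
have fin : (\int[nu]_x (u x ^+ 2)%:E < +oo)%E.
  rewrite ltNge leye_eq; apply/negP => /eqP hi; move: h.
  by rewrite hi addey.
have iu : nu.-integrable setT (EFin \o (fun x => u x ^+ 2)).
  by apply: integrable_ge0_lty => // [|x]; [mfun|exact: sqr_ge0].
by split => //; apply: EFin_inj; rewrite EFinD EFin_Rintegral.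
Qed.

Lemma directional_Rintegral (h : R -> R) C : measurable_fun setT h ->
  (forall x, `|h x| <= C) ->
  nu.-integrable setT (EFin \o (fun x => u x ^+ 2 * h (u x))) /\
  V * \int[Q]_w h (Y w) = v * h 0 + \int[nu]_x (u x ^+ 2 * h (u x)).
Proof.
move=> mh hC; have [iu uV] := directional_variance.
have hC0 z : 0 <= h z + C by have := hC z; rewrite ler_norml => /andP[? _]; lra.
have iuh : nu.-integrable setT (EFin \o (fun x => u x ^+ 2 * h (u x))).
  apply: (ge0_le_integrable (g := fun x => C * u x ^+ 2)).
  - by apply: measurable_mulf; [mfun|exact: measurableT_comp].
  - by move=> x; rewrite normrM (ger0_norm (sqr_ge0 _)) mulrC ler_wpM2r ?sqr_ge0.
  - exact: integrable_scalef.
split => //.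
have ih : Q.-integrable setT (EFin \o (fun w => h (Y w))).
  by apply: (@prob_bounded_integrable _ _ _ Q _ C) => //; exact: measurableT_comp.
have iC : Q.-integrable setT (EFin \o (fun=> C)).
  by apply: (@prob_bounded_integrable _ _ _ Q _ `|C|).
have mhC : measurable_fun setT (fun x => (h x + C)%:E) by apply/measurable_EFinP; mfun.
have := directional_ge0_integral mhC (fun x => hC0 x).
rewrite -(EFin_Rintegral (integrable_addf ih iC)) RintegralD// prob_Rintegral_cst.
have iCu := integrable_scalef C iu.
have -> : (\int[nu]_x ((u x ^+ 2)%:E * (h (u x) + C)%:E) =
    (\int[nu]_x (u x ^+ 2 * h (u x)) + C * \int[nu]_x (u x ^+ 2))%:E)%E.
  rewrite -RintegralZl// -RintegralD// EFin_Rintegral; last exact: integrable_addf.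
  by apply: eq_integral => x _; rewrite -EFinM; congr EFin; ring.
have uVC : C * (v + \int[nu]_x (u x ^+ 2)) = C * V by rewrite uV.
by rewrite -!EFinM -EFinD => -[]; lra.
Qed.

End DirectionalLaw.

(** * Beta and uniform averages of exponentials and trigonometric functions *)

Section BetaIntegrals.
Context (d : measure_display) (T : measurableType d) (R : realType).
Context (Q : probability T R) (B : {RV Q >-> R}).
Hypothesis hB : beta12_law B.
Implicit Types a b z s : R.

(* The distribution function of the law Beta(1,2), so that [beta12_cdf B] is
   uniform on the unit interval. *)
Definition beta12_cdf b : R := 1 - (1 - b) ^+ 2.

Lemma derive_beta12_cdf b : is_derive b 1 beta12_cdf (2 * (1 - b)).
Proof. by rewrite /beta12_cdf; derive; rewrite ?scaler1; ring. Qed.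

Lemma beta12_cdf_le1 b : beta12_cdf b <= 1.
Proof. by rewrite /beta12_cdf gerBl sqr_ge0. Qed.

Lemma measurable_beta12_cdf (d' : measure_display) (T' : measurableType d')
    (f : T' -> R) : measurable_fun setT f ->
  measurable_fun setT (fun x => beta12_cdf (f x)).
Proof. by move=> mf; rewrite /beta12_cdf; mfun. Qed.

Lemma beta12_Rintegral (g G : R -> R) C : (forall b, `|g b| <= C) -> continuous g ->
  (forall b : R, is_derive b 1 G (2 * (1 - b) * g b)) ->
  \int[Q]_w g (B w) = G 1 - G 0.
Proof.
move=> gC cg dG.
have mg : measurable_fun setT g by exact: continuous_measurable_fun.
have g0 b : 0 <= g b + C by have := gC b; rewrite ler_norml => /andP[? _]; lra.
have ig : Q.-integrable setT (EFin \o (fun w => g (B w))).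
  by apply: (@prob_bounded_integrable _ _ _ Q _ C) => //; exact: measurableT_comp.
have iC : Q.-integrable setT (EFin \o (fun=> C)).
  by apply: (@prob_bounded_integrable _ _ _ Q _ `|C|).
have cgC : continuous (fun b => g b + C) by move=> b; apply: cvgD; [exact: cg|exact: cvg_cst].
(* [beta12_cdf] is a primitive of the density, so it accounts for the constant [C] that makes [g]
   nonnegative; it grows by 1 from 0 to 1. *)
have dGC b : is_derive b 1 (fun b => G b + C * beta12_cdf b) (2 * (1 - b) * (g b + C)).
  have := derive_add (dG b) (derive_mul (derive_cst b C) (derive_beta12_cdf b)).
  by move/is_derive_eq; apply; ring.
have := beta12_expectation hB g0 cgC dGC.
rewrite -EFin_Rintegral; last exact: integrable_addf.
move=> -[]; rewrite RintegralD// prob_Rintegral_cst /beta12_cdf; lra.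
Qed.

Let continuous_expM a : continuous (fun b : R => expR (a * b)).
Proof.
apply: (is_derive_continuous (df := fun b => a * expR (a * b))) => b.
by derive; ring.
Qed.

(** Integral remainder at order two, the primitive [G] coming from an integration by parts.
    [beta12_cos] and [beta12_sin] are the real and imaginary parts of its analogue at an imaginary
    argument. *)
Lemma beta12_exp a : (\int[Q]_w (expR (a * B w))%:E = (2 * exp_rem2 1 a)%:E)%E.
Proof.
have [->|a0] := eqVneq a 0.
  rewrite /exp_rem2 eqxx expr1n; under eq_integral do rewrite mul0r expR0.
  rewrite integral_cst// mul1e mulrC divfK// ?pnatr_eq0//; exact: probability_setT.
pose G b := 2 * ((1 - b) * expR (a * b) / a + expR (a * b) / a ^+ 2).
have dG b : is_derive b 1 G (2 * (1 - b) * (fun b => expR (a * b)) b).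
  by rewrite /G; derive; field.
have cg : continuous (fun b => expR (a * b)).
  exact: continuous_expM.
rewrite (@beta12_expectation _ _ _ _ _ hB (fun b => expR (a * b)) G (fun b => expR_ge0 _) cg dG).
rewrite /G /exp_rem2 (negbTE a0) mul1r mulr1 mulr0 expR0; congr EFin; by field.
Qed.

Lemma beta12_cos a : a ^+ 2 / 2 * \int[Q]_w cos (a * B w) = 1 - cos a.
Proof.
have [->|a0] := eqVneq a 0; first by rewrite expr0n !mul0r cos0 subrr.
pose G b := 2 * ((1 - b) * sin (a * b) / a - cos (a * b) / a ^+ 2).
have dG b : is_derive b 1 G (2 * (1 - b) * (fun b => cos (a * b)) b).
  by rewrite /G; derive; field.
have cg : continuous (fun b => cos (a * b)).
  apply: (is_derive_continuous (df := fun b => - sin (a * b) * a)) => b.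
  by derive; ring.
rewrite (@beta12_Rintegral (fun b => cos (a * b)) G 1 (fun b => cos_max _) cg dG).
by rewrite /G mulr1 mulr0 cos0 sin0; field.
Qed.

Lemma beta12_sin a : a ^+ 2 / 2 * \int[Q]_w sin (a * B w) = a - sin a.
Proof.
have [->|a0] := eqVneq a 0; first by rewrite expr0n !mul0r sin0 subrr.
pose G b := - 2 * ((1 - b) * cos (a * b) / a + sin (a * b) / a ^+ 2).
have dG b : is_derive b 1 G (2 * (1 - b) * (fun b => sin (a * b)) b).
  by rewrite /G; derive; field.
have cg : continuous (fun b => sin (a * b)).
  apply: (is_derive_continuous (df := fun b => cos (a * b) * a)) => b.
  by derive; ring.
rewrite (@beta12_Rintegral (fun b => sin (a * b)) G 1 (fun b => sin_max _) cg dG).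
by rewrite /G mulr1 mulr0 cos0 sin0; field.
Qed.

(** As [2 * (1 - b)] is the derivative of [beta12_cdf], the chain rule gives the primitive: in
    effect an average over a uniform variable. *)
Lemma unif_exp a :
  (\int[Q]_w (expR (a * beta12_cdf (B w)))%:E = (exp_rem1 1 a)%:E)%E.
Proof.
have [->|a0] := eqVneq a 0.
  rewrite /exp_rem1 eqxx; under eq_integral do rewrite mul0r expR0.
  rewrite integral_cst// mul1e; exact: probability_setT.
have dG b : is_derive b 1 (fun b => expR (a * beta12_cdf b) / a) (2 * (1 - b) * (fun b => expR (a * beta12_cdf b)) b).
  by rewrite /beta12_cdf; derive; field.
have cg : continuous (fun b => expR (a * beta12_cdf b)).
  apply: (is_derive_continuous (df := fun b => a * expR (a * beta12_cdf b) * (2 * (1 - b)))) => b.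
  by rewrite /beta12_cdf; derive; ring.
rewrite (@beta12_expectation _ _ _ _ _ hB (fun b => expR (a * beta12_cdf b)) (fun b => expR (a * beta12_cdf b) / a) (fun b => expR_ge0 _) cg dG).
rewrite /beta12_cdf /exp_rem1 (negbTE a0) mul1r subrr expr0n subr0 expr1n subrr.
  by rewrite mulr1 mulr0 expR0; congr EFin; field.
Qed.

Lemma unif_cos a : a * \int[Q]_w cos (a * beta12_cdf (B w)) = sin a.
Proof.
have [->|a0] := eqVneq a 0; first by rewrite mul0r sin0.
have dG b : is_derive b 1 (fun b => sin (a * beta12_cdf b) / a) (2 * (1 - b) * (fun b => cos (a * beta12_cdf b)) b).
  by rewrite /beta12_cdf; derive; field.
have cg : continuous (fun b => cos (a * beta12_cdf b)).
  apply: (is_derive_continuous (df := fun b => - sin (a * beta12_cdf b) * a * (2 * (1 - b)))) => b.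
  by rewrite /beta12_cdf; derive; ring.
rewrite (@beta12_Rintegral (fun b => cos (a * beta12_cdf b)) (fun b => sin (a * beta12_cdf b) / a) 1 (fun b => cos_max _) cg dG).
rewrite /beta12_cdf subrr expr0n subr0 expr1n subrr.
  by rewrite mulr1 mulr0 sin0; field.
Qed.

Lemma unif_sin a : a * \int[Q]_w sin (a * beta12_cdf (B w)) = 1 - cos a.
Proof.
have [->|a0] := eqVneq a 0; first by rewrite mul0r cos0 subrr.
have dG b : is_derive b 1 (fun b => - cos (a * beta12_cdf b) / a) (2 * (1 - b) * (fun b => sin (a * beta12_cdf b)) b).
  by rewrite /beta12_cdf; derive; field.
have cg : continuous (fun b => sin (a * beta12_cdf b)).
  apply: (is_derive_continuous (df := fun b => cos (a * beta12_cdf b) * a * (2 * (1 - b)))) => b.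
  by rewrite /beta12_cdf; derive; ring.
rewrite (@beta12_Rintegral (fun b => sin (a * beta12_cdf b)) (fun b => - cos (a * beta12_cdf b) / a) 1 (fun b => sin_max _) cg dG).
rewrite /beta12_cdf subrr expr0n subr0 expr1n subrr.
  by rewrite mulr1 mulr0 cos0; field.
Qed.

Lemma exp_rem1_scale s z : s != 0 -> s * exp_rem1 1 (s * z) = exp_rem1 s z.
Proof.
move=> s0; rewrite /exp_rem1 mulf_eq0 (negbTE s0)/= mul1r.
have [_|z0] := eqVneq z 0; first by rewrite mulr1.
by field; rewrite s0 z0.
Qed.

Lemma exp_rem2_scale s z : s ^+ 2 * exp_rem2 1 (s * z) = exp_rem2 s z.
Proof.
have [->|s0] := eqVneq s 0; first by rewrite exp_rem2_0 expr0n mul0r.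
rewrite /exp_rem2 mulf_eq0 (negbTE s0)/= mul1r.
have [_|z0] := eqVneq z 0; first by rewrite expr1n mulrA mulr1.
by field; rewrite s0 z0.
Qed.

Variable Y : {RV Q >-> R}.
Hypothesis hBY : independent_pair B Y.

Let mB : measurable_fun setT B. Proof. by []. Qed.
Let mY : measurable_fun setT Y. Proof. by []. Qed.
Let mfst : measurable_fun setT (fun z : R * R => z.1). Proof. exact: measurable_fst. Qed.
Let msnd : measurable_fun setT (fun z : R * R => z.2). Proof. exact: measurable_snd. Qed.
Let mcdf : measurable_fun setT (fun z : R * R => beta12_cdf z.1).
Proof. exact: measurable_beta12_cdf. Qed.

Lemma unif_exp_scale s z : 0 < s ->
  (s%:E * \int[Q]_w (expR (s * (beta12_cdf (B w) * z)))%:E = (exp_rem1 s z)%:E)%E.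
Proof.
move=> s0; rewrite -(@exp_rem1_scale s z) ?gt_eqF// EFinM -unif_exp.
congr (_ * _)%E; apply: eq_integral => w _; congr (expR _)%:E; ring.
Qed.

Lemma unif_mul_exp s : 0 < s ->
  (s%:E * \int[Q]_w (expR (s * (beta12_cdf (B w) * Y w)))%:E =
   \int[Q]_w (exp_rem1 s (Y w))%:E)%E.
Proof.
move=> s0.
have mF : measurable_fun setT (fun z : R * R => (expR (s * (beta12_cdf z.1 * z.2)))%:E).
  by apply/measurable_EFinP; mfun.
rewrite (independent_ge0_integral hBY mF); last by move=> z; rewrite lee_fin expR_ge0.
rewrite -ge0_integralZl//; last 3 first.
- rewrite (_ : (fun y => _) = (fun y => (exp_rem1 1 (s * Y y))%:E)); last first.
    apply/funext => y; rewrite -unif_exp.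
    by apply: eq_integral => w _; congr (expR _)%:E; rewrite /=; ring.
  by apply/measurable_EFinP; apply: measurable_exp_rem1; mfun.
- by move=> y _; apply: integral_ge0 => w _; rewrite lee_fin expR_ge0.
- by rewrite lee_fin ltW.
by apply: eq_integral => y _; exact: unif_exp_scale.
Qed.

(** Brings the right side of the cumulant formula to the kernel [exp_rem2], by averaging over [B] at
    a fixed value of [Y]. *)
Lemma beta12_mul_exp s :
  ((s ^+ 2 / 2)%:E * \int[Q]_w (expR (s * (B w * Y w)))%:E =
   \int[Q]_w (exp_rem2 s (Y w))%:E)%E.
Proof.
have mF : measurable_fun setT (fun z : R * R => (expR (s * (z.1 * z.2)))%:E).
  by apply/measurable_EFinP; mfun.
rewrite (independent_ge0_integral hBY mF); last by move=> z; rewrite lee_fin expR_ge0.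
have e y : (\int[Q]_w (expR (s * (B w * Y y)))%:E = (2 * exp_rem2 1 (s * Y y))%:E)%E.
  by rewrite -beta12_exp; apply: eq_integral => w _; congr (expR _)%:E; ring.
rewrite -ge0_integralZl//; last 3 first.
- rewrite (_ : (fun y => _) = (fun y => (2 * exp_rem2 1 (s * Y y))%:E)); last first.
    by apply/funext => y; rewrite -e.
  apply/measurable_EFinP; apply: measurable_mulf => //.
  by apply: measurable_exp_rem2; mfun.
- by move=> y _; apply: integral_ge0 => w _; rewrite lee_fin expR_ge0.
- by rewrite lee_fin divr_ge0 ?sqr_ge0.
apply: eq_integral => y _; rewrite e -EFinM; congr EFin.
by rewrite -(exp_rem2_scale s); field.
Qed.

End BetaIntegrals.

(** * Elementary bounds on sine and cosine *)

Section TrigonometricBounds.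
Context {R : realType}.
Implicit Types x : R.

(** Mean value theorem, applied below with [M] equal to 1 or to the absolute value of [x]. The
    resulting constants are not sharp; they serve for domination only. *)
Lemma derive_bound (f df : R -> R) x M : (forall t : R, is_derive t 1 f (df t)) ->
  (forall t, `|t| <= `|x| -> `|df t| <= M) -> `|f x - f 0| <= M * `|x|.
Proof.
move=> h hM; have cf := is_derive_continuous h.
have [x0|x0|->] := ltgtP x 0; last by rewrite subrr !normr0 mulr0.
- have [c] := @MVT _ f df _ _ x0 (fun t _ => h t) (continuous_subspaceT cf).
  rewrite in_itv/= => /andP[xc c0]; rewrite sub0r => e.
  rewrite distrC e normrM normrN ler_wpM2r// hM// !ltr0_norm//; lra.
- have [c] := @MVT _ f df _ _ x0 (fun t _ => h t) (continuous_subspaceT cf).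
  rewrite in_itv/= => /andP[c0 cx]; rewrite subr0 => e.
  rewrite e normrM ler_wpM2r// hM// !gtr0_norm//; lra.
Qed.

Lemma normr_sin_le x : `|sin x| <= `|x|.
Proof.
have := @derive_bound sin cos x 1 (fun t => is_derive_sin t) (fun t _ => cos_max t).
by rewrite sin0 subr0 mul1r.
Qed.

Lemma normr_1Bcos_le x : `|1 - cos x| <= `|x|.
Proof.
have := @derive_bound cos (fun t => - sin t) x 1 (fun t => is_derive_cos t).
rewrite cos0 mul1r distrC; apply => t _; rewrite normrN; exact: sin_max.
Qed.

Lemma normr_1Bcos_le2 x : `|1 - cos x| <= x ^+ 2.
Proof.
have := @derive_bound cos (fun t => - sin t) x `|x| (fun t => is_derive_cos t).
rewrite cos0 distrC -normrM -expr2 ger0_norm ?sqr_ge0//; apply => t tx.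
by rewrite normrN (le_trans (normr_sin_le t)).
Qed.

Lemma normr_sinB_le x : `|sin x - x| <= x ^+ 2.
Proof.
have d (t : R) : is_derive t 1 (fun t : R => sin t - t) (cos t - 1) by derive; ring.
have := @derive_bound (fun t => sin t - t) (fun t => cos t - 1) x `|x| d.
rewrite sin0 !subr0 -normrM -expr2 (ger0_norm (sqr_ge0 x)); apply => t tx.
by rewrite distrC (le_trans (normr_1Bcos_le t)).
Qed.

End TrigonometricBounds.

(** Tonelli gives measurability for the nonnegative [F + C], and the constant is subtracted
    afterwards. *)
Lemma measurable_Rintegral_snd (d : measure_display) (T : measurableType d)
    (R : realType) (Q : probability T R) (F : R * T -> R) C :
  measurable_fun setT F -> (forall z, `|F z| <= C) ->
  measurable_fun setT (fun y => \int[Q]_w F (y, w)).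
Proof.
move=> mF FC.
have FC0 z : 0 <= F z + C by have := FC z; rewrite ler_norml => /andP[? _]; lra.
have iF y : Q.-integrable setT (EFin \o (fun w => F (y, w))).
  apply: (@prob_bounded_integrable _ _ _ Q _ C) => //.
  by apply: measurableT_comp mF _; exact: measurable_fun_pair.
have iC : Q.-integrable setT (EFin \o (fun=> C)).
  by apply: (@prob_bounded_integrable _ _ _ Q _ `|C|).
have mFC : measurable_fun setT (fun z => (F z + C)%:E) by apply/measurable_EFinP; mfun.
have := @measurable_fun_fubini_tonelli_F _ _ _ _ _ Q _ mFC (fun z => FC0 z).
rewrite (_ : fubini_F _ _ = (fun y => (\int[Q]_w F (y, w) + C)%:E)); last first.
  apply/funext => y; rewrite -{2}(prob_Rintegral_cst Q C) -RintegralD//.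
  by rewrite EFin_Rintegral//; exact: integrable_addf.
move=> /measurable_EFinP m.
rewrite (_ : (fun y => _) = (fun y => \int[Q]_w F (y, w) + C + - C)); first by mfun.
by apply/funext => y; rewrite addrK.
Qed.

(** * The one-dimensional problem along a fixed direction *)

Section OneDimension.
Context (d d1 d2 : measure_display) (T : measurableType d) (T1 : measurableType d1).
Context (T2 : measurableType d2) (R : realType).
Context (P : probability T R) (Z : T -> R).
Context (nu : {measure set T1 -> \bar R}) (u : T1 -> R).
Context (Q : probability T2 R) (B Y : {RV Q >-> R}) (v V : R).
Hypotheses (mZ : measurable_fun setT Z) (intZ : P.-integrable setT (EFin \o Z))
  (intZ2 : P.-integrable setT (EFin \o (fun x => Z x ^+ 2)))
  (EZ : \int[P]_x Z x = 0) (EZ2 : \int[P]_x (Z x ^+ 2) = V).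
Hypotheses (mu : measurable_fun setT u) (v0 : 0 <= v) (V0 : 0 < V).
Hypothesis hB : beta12_law B.
Hypothesis hY : forall S : set R, measurable S ->
  distribution Q Y S = ((v%:E * \d_(0%R : R) S +
    \int[nu]_(x in [set x | S (u x)]) (u x ^+ 2)%:E) * (V^-1)%:E)%E.
Hypothesis hBY : independent_pair B Y.

(** The characteristic exponent of [Z] has real part [- C r] and imaginary part [S r + r * c]: the
    jumps are fully compensated and [c] is the drift that remains. *)
Let C (r : R) := v * r ^+ 2 / 2 + \int[nu]_x (1 - cos (r * u x)).
Let S (r : R) := \int[nu]_x (sin (r * u x) - r * u x).

Variable c : R.
Hypothesis cosZ : forall r : R,
  \int[P]_x cos (r * Z x) = expR (- C r) * cos (S r + r * c).
Hypothesis sinZ : forall r : R,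
  \int[P]_x sin (r * Z x) = expR (- C r) * sin (S r + r * c).

Let iu2 : nu.-integrable setT (EFin \o (fun x => u x ^+ 2)).
Proof. by have [] := directional_variance mu v0 V0 hY. Qed.

Let mB : measurable_fun setT B. Proof. by []. Qed.
Let mY : measurable_fun setT Y. Proof. by []. Qed.
Let mfst : measurable_fun setT (fun z : R * R => z.1). Proof. exact: measurable_fst. Qed.
Let msnd : measurable_fun setT (fun z : R * R => z.2). Proof. exact: measurable_snd. Qed.
Let mcdf : measurable_fun setT (fun z : R * R => beta12_cdf z.1).
Proof. exact: measurable_beta12_cdf. Qed.

(** Independence combined with the law of [Y]: a Gaussian term, where [Y] becomes 0, plus a jump
    term, where it becomes [u x]. [CE], [SE], [alphaE] and [betaE] are instances. *)
Let directional_mix (F : R * R -> R) (K : R) : measurable_fun setT F ->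
  (forall z, `|F z| <= K) ->
  V * \int[Q]_w F (B w, Y w) =
    v * \int[Q]_w F (B w, 0) + \int[nu]_x (u x ^+ 2 * \int[Q]_w F (B w, u x)) /\
  nu.-integrable setT (EFin \o (fun x => u x ^+ 2 * \int[Q]_w F (B w, u x))).
Proof.
move=> mF FK; rewrite (independent_Rintegral hBY mF FK).
have mF' : measurable_fun setT (fun z : R * T2 => F (B z.2, z.1)).
  apply: measurableT_comp mF _; apply: measurable_fun_pair; last exact: measurable_fst.
  by apply: measurableT_comp => //; exact: measurable_snd.
have mh := @measurable_Rintegral_snd _ _ _ Q (fun z => F (B z.2, z.1)) K mF' (fun z => FK _).
have hK (y : R) : `|\int[Q]_w F (B w, y)| <= K.
  have mFy : measurable_fun setT (fun w => F (B w, y)).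
    by apply: measurableT_comp mF _; exact: measurable_fun_pair.
  have iF := @prob_bounded_integrable _ _ _ Q _ K mFy (fun w => FK _).
  apply: (le_trans (le_normr_Rintegral measurableT iF)).
  rewrite -(prob_Rintegral_cst Q K); apply: le_Rintegral => //.
    exact: integrable_norm.
  by apply: (@prob_bounded_integrable _ _ _ Q _ `|K|).
by have [i e] := directional_Rintegral mu v0 V0 hY mh hK; split.
Qed.

Let int1Bcos r : nu.-integrable setT (EFin \o (fun x => 1 - cos (r * u x))).
Proof.
apply: (ge0_le_integrable (g := fun x => r ^+ 2 * u x ^+ 2)).
- by mfun.
- by move=> x; rewrite -exprMn normr_1Bcos_le2.
- exact: integrable_scalef.
Qed.

Let intsinB r : nu.-integrable setT (EFin \o (fun x => sin (r * u x) - r * u x)).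
Proof.
apply: (ge0_le_integrable (g := fun x => r ^+ 2 * u x ^+ 2)).
- by mfun.
- by move=> x; rewrite -exprMn normr_sinB_le.
- exact: integrable_scalef.
Qed.

Let dC (r : R) : is_derive r 1 C (v * r + \int[nu]_x (u x * sin (r * u x))).
Proof.
have h : is_derive r 1 (fun r => \int[nu]_x (1 - cos (r * u x)))
    (\int[nu]_x (u x * sin (r * u x))).
  (* On the window of radius 1 the absolute value of [y] is at most that of [r] plus 1, whence the
     factor in the dominating function. *)
  refine (@is_derive_Rintegral _ _ R nu (fun r x => 1 - cos (r * u x))
    (fun r x => u x * sin (r * u x)) (fun x => (`|r| + 1) * u x ^+ 2) r _ _ _ _).
  - by move=> y; exact: int1Bcos.
  - by move=> y x; derive; ring.
  - exact: integrable_scalef.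
  - move=> y x yr; rewrite normrM.
    apply: (@le_trans _ _ (`|u x| * `|y * u x|)); first by rewrite ler_wpM2l ?normr_sin_le.
    rewrite normrM mulrCA -expr2 real_normK ?num_real// ler_wpM2r ?sqr_ge0//.
    by rewrite -[y](subrK r) (le_trans (ler_normD _ _))// addrC lerD2l ltW.
have h2 : is_derive r 1 (fun r : R => v * r ^+ 2 / 2) (v * r) by derive; field.
exact: derive_add h2 h.
Qed.

Let dS (r : R) : is_derive r 1 S (- \int[nu]_x (u x * (1 - cos (r * u x)))).
Proof.
have i1 : nu.-integrable setT (EFin \o (fun x => u x * (1 - cos (r * u x)))).
  apply: (ge0_le_integrable (g := fun x => `|r| * u x ^+ 2)).
  - by mfun.
  - move=> x; rewrite normrM -(real_normK (num_real (u x))) expr2 mulrCA ler_wpM2l//.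
    by rewrite -normrM normr_1Bcos_le.
  - exact: integrable_scalef.
have -> : - (\int[nu]_x (u x * (1 - cos (r * u x)))) =
    \int[nu]_x (u x * (cos (r * u x) - 1)).
  rewrite -[LHS]mulN1r -RintegralZl//; apply: eq_Rintegral => x _; ring.
refine (@is_derive_Rintegral _ _ R nu (fun r x => sin (r * u x) - r * u x)
  (fun r x => u x * (cos (r * u x) - 1)) (fun x => (`|r| + 1) * u x ^+ 2) r _ _ _ _).
- by move=> y; exact: intsinB.
- by move=> y x; derive; ring.
- exact: integrable_scalef.
- move=> y x yr; rewrite normrM distrC.
  apply: (@le_trans _ _ (`|u x| * `|y * u x|)); first by rewrite ler_wpM2l ?normr_1Bcos_le.
  rewrite normrM mulrCA -expr2 real_normK ?num_real// ler_wpM2r ?sqr_ge0//.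
  by rewrite -[y](subrK r) (le_trans (ler_normD _ _))// addrC lerD2l ltW.
Qed.

Let dcosZ (r : R) : is_derive r 1 (fun r => \int[P]_x cos (r * Z x))
  (\int[P]_x (- (Z x * sin (r * Z x)))).
Proof.
refine (@is_derive_Rintegral _ _ R P (fun r x => cos (r * Z x))
  (fun r x => - (Z x * sin (r * Z x))) (fun x => `|Z x|) r _ _ _ _).
- move=> y; apply: (@prob_bounded_integrable _ _ _ P _ 1) => [|x]; [by mfun|exact: cos_max].
- by move=> y x; derive; ring.
- exact: integrable_norm.
- by move=> y x _; rewrite normrN normrM ler_piMr// sin_max.
Qed.

Let dsinZ (r : R) : is_derive r 1 (fun r => \int[P]_x sin (r * Z x))
  (\int[P]_x (Z x * cos (r * Z x))).
Proof.
refine (@is_derive_Rintegral _ _ R P (fun r x => sin (r * Z x))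
  (fun r x => Z x * cos (r * Z x)) (fun x => `|Z x|) r _ _ _ _).
- move=> y; apply: (@prob_bounded_integrable _ _ _ P _ 1) => [|x]; [by mfun|exact: sin_max].
- by move=> y x; derive; ring.
- exact: integrable_norm.
- by move=> y x _; rewrite normrM ler_piMr// cos_max.
Qed.

(** In the jump term [beta12_cos] at [r * u x] produces [1 - cos (r * u x)]; in the Gaussian term
    the cosine is 1. *)
Let CE r : C r = V * r ^+ 2 / 2 * \int[Q]_w cos (r * (B w * Y w)).
Proof.
have mF : measurable_fun setT (fun z : R * R => cos (r * (z.1 * z.2))) by mfun.
have [e i] := directional_mix mF (fun z => cos_max _).
rewrite (_ : V * r ^+ 2 / 2 * _ = r ^+ 2 / 2 * (V * \int[Q]_w cos (r * (B w * Y w)))); last by ring.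
rewrite e; have -> : \int[Q]_w cos (r * (B w * 0)) = 1.
  by under eq_Rintegral do rewrite !mulr0 cos0; rewrite prob_Rintegral_cst.
rewrite mulrDr -RintegralZl// /C; congr (_ + _); first by ring.
apply: eq_Rintegral => x _; rewrite -(beta12_cos hB) /=.
rewrite exprMn.
have -> : \int[Q]_w cos (r * u x * B w) = \int[Q]_w cos (r * (B w * u x)).
  by apply: eq_Rintegral => w _; congr cos; ring.
by field.
Qed.

Let SE r : S r = - (V * r ^+ 2 / 2 * \int[Q]_w sin (r * (B w * Y w))).
Proof.
have mF : measurable_fun setT (fun z : R * R => sin (r * (z.1 * z.2))) by mfun.
have [e i] := directional_mix mF (fun z => sin_max _).
rewrite (_ : V * r ^+ 2 / 2 * _ = r ^+ 2 / 2 * (V * \int[Q]_w sin (r * (B w * Y w)))); last by ring.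
rewrite e; have -> : \int[Q]_w sin (r * (B w * 0)) = 0.
  by under eq_Rintegral do rewrite !mulr0 sin0; rewrite prob_Rintegral_cst.
rewrite mulr0 add0r -mulNr -RintegralZl// /S.
apply: eq_Rintegral => x _; rewrite -[LHS]opprB -(beta12_sin hB) /= exprMn.
have -> : \int[Q]_w sin (r * u x * B w) = \int[Q]_w sin (r * (B w * u x)).
  by apply: eq_Rintegral => w _; congr sin; ring.
by field.
Qed.

(** The derivative of [C] in terms of the uniform variable: [unif_cos] at [r * u x] uses one of the
    two factors [u x] and leaves the other. *)
Let alphaE r : v * r + \int[nu]_x (u x * sin (r * u x)) =
  V * (r * \int[Q]_w cos (r * (beta12_cdf (B w) * Y w))).
Proof.
have mF : measurable_fun setT (fun z : R * R => cos (r * (beta12_cdf z.1 * z.2))) by mfun.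
have [e i] := directional_mix mF (fun z => cos_max _).
rewrite mulrCA e; have -> : \int[Q]_w cos (r * (beta12_cdf (B w) * 0)) = 1.
  by under eq_Rintegral do rewrite !mulr0 cos0; rewrite prob_Rintegral_cst.
rewrite mulrDr -RintegralZl//; congr (_ + _); first by ring.
apply: eq_Rintegral => x _; rewrite -(unif_cos hB (r * u x)) /=.
have -> : \int[Q]_w cos (r * u x * beta12_cdf (B w)) =
    \int[Q]_w cos (r * (beta12_cdf (B w) * u x)).
  by apply: eq_Rintegral => w _; congr cos; ring.
by ring.
Qed.

Let betaE r : \int[nu]_x (u x * (1 - cos (r * u x))) =
  V * (r * \int[Q]_w sin (r * (beta12_cdf (B w) * Y w))).
Proof.
have mF : measurable_fun setT (fun z : R * R => sin (r * (beta12_cdf z.1 * z.2))) by mfun.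
have [e i] := directional_mix mF (fun z => sin_max _).
rewrite mulrCA e; have -> : \int[Q]_w sin (r * (beta12_cdf (B w) * 0)) = 0.
  by under eq_Rintegral do rewrite !mulr0 sin0; rewrite prob_Rintegral_cst.
rewrite mulr0 add0r -RintegralZl//.
apply: eq_Rintegral => x _; rewrite -(unif_sin hB (r * u x)) /=.
have -> : \int[Q]_w sin (r * u x * beta12_cdf (B w)) =
    \int[Q]_w sin (r * (beta12_cdf (B w) * u x)).
  by apply: eq_Rintegral => w _; congr sin; ring.
by ring.
Qed.

(** Two expressions for the derivative of the characteristic function of [Z], one taken under the
    expectation and one from its exponential form. Here [alpha] is the derivative of [C] and
    [- beta] that of [S]. *)
Let derivE r (alpha := V * (r * \int[Q]_w cos (r * (beta12_cdf (B w) * Y w))))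
    (beta := V * (r * \int[Q]_w sin (r * (beta12_cdf (B w) * Y w)))) :
  \int[P]_x (Z x * sin (r * Z x)) = alpha * \int[P]_x cos (r * Z x)
    + (c - beta) * \int[P]_x sin (r * Z x) /\
  \int[P]_x (Z x * cos (r * Z x)) = (c - beta) * \int[P]_x cos (r * Z x)
    - alpha * \int[P]_x sin (r * Z x).
Proof.
have dphase : is_derive r 1 (fun r => S r + r * c) (- beta + (r * 0 + c * 1)).
  by apply: derive_add; rewrite /beta -betaE; exact: dS.
have dexp : is_derive r 1 (fun r => expR (- C r)) (expR (- C r) * - alpha).
  by apply: derive_exp; apply: derive_opp; rewrite /alpha -alphaE; exact: dC.
have uniq (f : R -> R) (df dg : R) : is_derive r 1 f df -> is_derive r 1 f dg -> df = dg.
  by move=> [_ <-] [_ <-].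
have iZs : P.-integrable setT (EFin \o (fun x => Z x * sin (r * Z x))).
  apply: (ge0_le_integrable (g := fun x => `|Z x|)); first by mfun.
    by move=> x; rewrite normrM ler_piMr// sin_max.
  exact: integrable_norm.
have fc : (fun r => \int[P]_x cos (r * Z x)) = (fun r => expR (- C r) * cos (S r + r * c)).
  by apply/funext => y; exact: cosZ.
have fs : (fun r => \int[P]_x sin (r * Z x)) = (fun r => expR (- C r) * sin (S r + r * c)).
  by apply/funext => y; exact: sinZ.
have hc := dcosZ r; have hs := dsinZ r; rewrite fc in hc; rewrite fs in hs.
have := uniq _ _ _ hc (derive_mul dexp (derive_cos dphase)).
have := uniq _ _ _ hs (derive_mul dexp (derive_sin dphase)).
have -> : \int[P]_x (- (Z x * sin (r * Z x))) = - (\int[P]_x (Z x * sin (r * Z x))).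
  by rewrite -[RHS]mulN1r -RintegralZl//; apply: eq_Rintegral => x _; rewrite mulN1r.
rewrite cosZ sinZ => h1 h2; split; last by rewrite h1; ring.
by rewrite -[LHS]opprK h2; ring.
Qed.

(** At [r = 0] the second identity of [derivE] reads E Z = c, and [Z] is centered. *)
Let c0 : c = 0.
Proof.
have [_] := derivE 0; rewrite !mul0r !mulr0 !subr0 mul0r subr0.
have -> : \int[P]_x (Z x * cos (0 * Z x)) = 0.
  by rewrite -[RHS]EZ; apply: eq_Rintegral => x _; rewrite mul0r cos0 mulr1.
have -> : \int[P]_x cos (0 * Z x) = 1.
  by under eq_Rintegral do rewrite mul0r cos0; rewrite prob_Rintegral_cst.
by rewrite mulr1.
Qed.

Let iZbound (g : R -> R) r : measurable_fun setT g -> (forall x, `|g x| <= 1) ->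
  P.-integrable setT (EFin \o (fun x => Z x * g (r * Z x))).
Proof.
move=> mg g1; apply: (ge0_le_integrable (g := fun x => `|Z x|)).
- by apply: measurable_mulf => //; apply: measurableT_comp mg _; mfun.
- by move=> x; rewrite normrM ler_piMr.
- exact: integrable_norm.
Qed.

(** Averaging [g] over the uniform variable integrates it, at the cost of one factor [Z]. For [g] a
    cosine or a sine, the right side is, up to sign and the vanishing mean of [Z], an expectation
    computed in [derivE]. *)
Let size_biasE (g : R -> R) r (G : R -> R) :
  r != 0 -> measurable_fun setT g -> (forall x, `|g x| <= 1) ->
  (forall a, a * \int[Q]_w g (a * beta12_cdf (B w)) = G a) ->
  r * \int[P]_x (Z x ^+ 2 * \int[Q]_w g (r * (beta12_cdf (B w) * Z x))) =
  \int[P]_x (Z x * G (r * Z x)).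
Proof.
move=> r0 mg g1 gG.
have e x : Z x ^+ 2 * \int[Q]_w g (r * (beta12_cdf (B w) * Z x)) =
    r^-1 * (Z x * G (r * Z x)).
  rewrite -gG; have -> : \int[Q]_w g (r * Z x * beta12_cdf (B w)) =
      \int[Q]_w g (r * (beta12_cdf (B w) * Z x)).
    by apply: eq_Rintegral => w _; congr g; ring.
  by field.
have iG : P.-integrable setT (EFin \o (fun x => Z x * G (r * Z x))).
  have mUg : measurable_fun setT (fun z : R * T2 => g (r * (beta12_cdf (B z.2) * z.1))).
    have mBz : measurable_fun setT (fun z : R * T2 => beta12_cdf (B z.2)).
      by apply: measurable_beta12_cdf; apply: measurableT_comp => //; exact: measurable_snd.
    have m1 : measurable_fun setT (fun z : R * T2 => z.1) by exact: measurable_fst.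
    by apply: measurableT_comp mg _; mfun.
  have mh := @measurable_Rintegral_snd _ _ _ Q _ 1 mUg (fun z => g1 _).
  apply: (ge0_le_integrable (g := fun x => `|r| * Z x ^+ 2)).
  (* [G] itself is not known to be measurable; [e] expresses the function through an integral
     depending on a parameter. *)
  - rewrite (_ : (fun x => _) = (fun x => r * (Z x ^+ 2 *
        \int[Q]_w g (r * (beta12_cdf (B w) * Z x))))).
      apply: measurable_mulf => //; apply: measurable_mulf; first by mfun.
      exact: (measurableT_comp mh mZ).
    by apply/funext => x; rewrite e mulrA mulfV// mul1r.
  - move=> x; rewrite -(mul1r (Z x * _)) -(mulfV r0) -mulrA -e normrM ler_wpM2l//.
    rewrite normrM (ger0_norm (sqr_ge0 _)) ler_piMr ?sqr_ge0//.
    have mgx : measurable_fun setT (fun w => g (r * (beta12_cdf (B w) * Z x))).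
      by apply: measurableT_comp mg _; mfun; exact: measurable_beta12_cdf.
    have ig := @prob_bounded_integrable _ _ _ Q _ 1 mgx (fun w => g1 _).
    apply: (le_trans (le_normr_Rintegral measurableT ig)).
    rewrite -[leRHS](prob_Rintegral_cst Q); apply: le_Rintegral => //.
      exact: integrable_norm.
    by apply: (@prob_bounded_integrable _ _ _ Q _ 1) => [|w]; [|rewrite normr1].
  - exact: integrable_scalef.
under eq_Rintegral do rewrite e.
by rewrite RintegralZl// mulrA mulfV// mul1r.
Qed.

(** The same [B] provides the uniform factor of [Z] and that of [Y]: they occur on opposite sides of
    the zero-bias identity, so their joint law does not enter. *)
Let W w := beta12_cdf (B w) * Y w.

Let mW : measurable_fun setT W.
Proof. by rewrite /W; mfun; exact: measurable_beta12_cdf. Qed.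

(** Multiplied by [r] and rewritten with [size_biasE], the Fourier identities asked by [zero_bias]
    are those of [derivE] with [c = 0]. *)
Let one_dim_bias (g : R -> \bar R) : measurable_fun setT g ->
  (forall x, (0 <= g x)%E) ->
  (\int[P]_x \int[Q]_y ((Z x ^+ 2)%:E * g (beta12_cdf (B y) * Z x)%R) =
   V%:E * \int[P]_x \int[Q]_y g (Z x + W y)%R)%E.
Proof.
apply: zero_bias => //.
- exact: measurable_beta12_cdf.
- move=> r r0; apply: (mulfI r0).
  rewrite (size_biasE (G := sin) r0 _ (fun x => cos_max x) (unif_cos hB)); last by mfun.
  have [-> _] := derivE r; rewrite c0 /W; ring.
- move=> r r0; apply: (mulfI r0).
  rewrite (size_biasE (G := fun a => 1 - cos a) r0 _ (fun x => sin_max x) (unif_sin hB)); last by mfun.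
  have i1 : P.-integrable setT (EFin \o (fun x => Z x * cos (r * Z x))).
    by apply: iZbound => //; [mfun|exact: cos_max].
  rewrite (@eq_Rintegral _ _ _ _ _ (fun x => Z x - Z x * cos (r * Z x))); last first.
    by move=> x _; ring.
  rewrite RintegralB// EZ.
  have [_ ->] := derivE r; rewrite c0 /W; ring.
Qed.

Theorem one_dim_cumulant (s : R) : 0 <= s ->
  (lne (\int[P]_x (expR (s * Z x))%:E) =
   (V * s ^+ 2 / 2)%:E * \int[Q]_w (expR (s * (B w * Y w)))%:E)%E.
Proof.
move=> s0.
rewrite (@zero_bias_cumulant _ _ _ _ _ P Q Z (fun w => beta12_cdf (B w)) W Y V) //.
- rewrite -mulrA EFinM -muleA beta12_mul_exp// -ge0_integralZl//.
  + by apply/measurable_EFinP; exact: measurable_exp_rem2.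
  + by move=> w _; rewrite lee_fin exp_rem2_ge0.
  + by rewrite lee_fin ltW.
- exact: measurable_beta12_cdf.
- by move=> w; exact: beta12_cdf_le1.
- by move=> a z a0; exact: unif_exp_scale.
- by move=> a a0; exact: unif_mul_exp.
Qed.

Theorem one_dim_charfun (r : R) :
  C r = V * r ^+ 2 / 2 * \int[Q]_w cos (r * (B w * Y w)) /\
  S r + r * c = - (V * r ^+ 2 / 2 * \int[Q]_w sin (r * (B w * Y w))).
Proof. by rewrite c0 mulr0 addr0. Qed.

Lemma one_dim_phase_continuous : continuous S.
Proof. exact: (is_derive_continuous dS). Qed.

End OneDimension.

(** * Linear forms, quadratic forms and sequential continuity on rows *)

Section DotProduct.
Context {R : realType} {n : nat}.
Implicit Types (t s : 'rV[R]_n) (x : n.-tuple R).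

Lemma measurable_dotp t : measurable_fun setT (dotp t).
Proof.
by apply: measurable_sum => i; apply: measurable_mulf => //; exact: measurable_tnth.
Qed.

Lemma measurable_sqnorm : measurable_fun setT (@sqnorm R n).
Proof.
by apply: measurable_sum => i; apply: measurable_expnf; exact: measurable_tnth.
Qed.

Lemma sqnorm_ge0 x : 0 <= sqnorm x.
Proof. by apply: sumr_ge0 => i _; exact: sqr_ge0. Qed.

Lemma dotpZ r t x : dotp (r *: t) x = r * dotp t x.
Proof. by rewrite /dotp mulr_sumr; apply: eq_bigr => i _; rewrite mxE mulrA. Qed.

Lemma qformZ (A : 'M[R]_n) r t : qform A (r *: t) = r ^+ 2 * qform A t.
Proof. by rewrite /qform linearZ/= -!scalemxAl -scalemxAr !mxE mulrA expr2. Qed.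

Lemma qformE (A : 'M[R]_n) t : qform A t = \sum_(i < n) \sum_(j < n) t 0 i * A i j * t 0 j.
Proof.
rewrite /qform mxE exchange_big; apply: eq_bigr => j _.
by rewrite !mxE mulr_suml; apply: eq_bigr => i _.
Qed.

Lemma sqr_tnth_le x i : tnth x i ^+ 2 <= sqnorm x.
Proof.
by rewrite /sqnorm (bigD1 i)//= lerDl sumr_ge0// => j _; exact: sqr_ge0.
Qed.

(** A crude Cauchy-Schwarz bound whose constant depends only on a bound for the entries, hence is
    uniform along a convergent sequence of rows. *)
Lemma sqr_dotp_le t x K : (forall i, `|t 0 i| <= K) ->
  dotp t x ^+ 2 <= (K * n%:R) ^+ 2 * sqnorm x.
Proof.
move=> tK; rewrite -(sqr_sqrtr (sqnorm_ge0 x)) -exprMn -(real_normK (num_real (dotp t x))).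
rewrite ler_sqr ?nnegrE//; last first.
  rewrite mulr_ge0 ?sqrtr_ge0//; case: n t x tK => [|m] t x tK; first by rewrite mulr0.
  by rewrite mulr_ge0// (le_trans _ (tK ord0)).
apply: (le_trans (ler_norm_sum _ _ _)).
rewrite [K * _]mulrC -mulrA -[X in X%:R * _](card_ord n) -sum1_card natr_sum mulr_suml.
apply: ler_sum => i _; rewrite mul1r normrM ler_pM//.
by rewrite -sqrtr_sqr ler_wsqrtr// sqr_tnth_le.
Qed.

Lemma cvg_dotp (u : nat -> 'rV[R]_n) t x :
  (forall i, (fun k => u k 0 i) @ \oo --> t 0 i) ->
  (fun k => dotp (u k) x) @ \oo --> dotp t x.
Proof.
move=> ut; apply: cvg_big => [|i _]; first by move=> z; exact: add_continuous.
by apply: cvgMl; exact: ut.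
Qed.

Lemma cvg_qform (A : 'M[R]_n) (u : nat -> 'rV[R]_n) t :
  (forall i, (fun k => u k 0 i) @ \oo --> t 0 i) ->
  (fun k => qform A (u k)) @ \oo --> qform A t.
Proof.
move=> ut; under eq_fun do rewrite qformE; rewrite qformE.
apply: cvg_big => [|i _]; first by move=> z; exact: add_continuous.
apply: cvg_big => [|j _]; first by move=> z; exact: add_continuous.
by apply: cvgM; [apply: cvgMl; exact: ut|exact: ut].
Qed.

(** Reduces continuity to sequences, along which dominated convergence applies. A failure of
    continuity yields, by choice, one bad point in each ball of radius [1 / k.+1]. *)
Lemma row_seq_continuous (F : 'rV[R]_n -> R) :
  (forall t (u : nat -> 'rV[R]_n),
    (forall k i, `|t 0 i - u k 0 i| < k.+1%:R^-1) ->
    (fun k => F (u k)) @ \oo --> F t) -> continuous F.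
Proof.
move=> h t.
suff : F s @[s --> nbhs t] --> F t by [].
apply/cvgrPdist_lt => e e0; apply: contrapT => nF.
have /choice[u hu] k : exists s, ball t (k.+1%:R^-1 : R) s /\ ~ `|F t - F s| < e.
  apply: contrapT => ns; apply: nF; apply/nbhs_ballP; exists k.+1%:R^-1 => //= s bs.
  by apply: contrapT => ne; apply: ns; exists s.
have hut k i : `|t 0 i - u k 0 i| < k.+1%:R^-1 by have [[_ /(_ 0 i)]] := hu k.
have /cvgrPdist_lt/(_ e e0)[N _ hN] := h t u hut.
by have [_] := hu N; apply; apply: hN => /=.
Qed.

End DotProduct.

Lemma cvg_of_inv_bound (R : realType) (a : R) (u : nat -> R) :
  (forall k, `|a - u k| < k.+1%:R^-1) -> u @ \oo --> a.
Proof.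
move=> h; apply: cvg_sub0 (cvg_cst a) => //.
apply: norm_cvg0; apply: squeeze_cvgr (cvg_cst 0) cvg_harmonic.
by apply: nearW => k /=; rewrite normr_ge0 distrC ltW.
Qed.

(** * Continuity of the Levy-Khintchine exponent *)

Section LevyKhintchine.
Context {R : realType} {n : nat}.
Variables (A : 'M[R]_n) (nu : {measure set (n.-tuple R) -> \bar R}) (gamma : n.-tuple R).
Hypothesis hnu : levy_measure nu.
Implicit Types (t s : 'rV[R]_n) (x : n.-tuple R).

Let trunc x : R := (sqnorm x <= 1)%R%:R.

Let mtrunc : measurable_fun setT trunc.
Proof.
rewrite (_ : trunc = fun x => if sqnorm x <= 1 then 1 else 0).
  apply: measurable_fun_ifT => //; apply: measurable_fun_ler => //.
  exact: measurable_sqnorm.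
by apply/funext => x; rewrite /trunc; case: ifP.
Qed.

Let imin : nu.-integrable setT (EFin \o (fun x => Num.min 1 (sqnorm x))).
Proof.
have [_ h] := hnu; apply: integrable_ge0_lty h.
  by apply: measurable_minr => //; exact: measurable_sqnorm.
by move=> x; rewrite le_min ler01 sqnorm_ge0.
Qed.

Definition lk_re t : R := - (qform A t / 2) + \int[nu]_x (cos (dotp t x) - 1).

Definition lk_im t : R := dotp t gamma +
  \int[nu]_x (sin (dotp t x) - dotp t x * (sqnorm x <= 1)%R%:R).

(** Where [sqnorm x <= 1] the quadratic bounds give the factor [M]; elsewhere the truncation
    vanishes and the integrands are at most 2. *)
Let min_bound t x K (M := (K * n%:R) ^+ 2) : (forall i, `|t 0 i| <= K) ->
  `|cos (dotp t x) - 1| <= (M + 2) * Num.min 1 (sqnorm x) /\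
  `|sin (dotp t x) - dotp t x * trunc x| <= (M + 2) * Num.min 1 (sqnorm x).
Proof.
move=> tK; have := sqr_dotp_le x tK; rewrite -/M => h.
have M0 : 0 <= M by exact: sqr_ge0.
have s0 := sqnorm_ge0 x; rewrite /trunc.
have [s1|s1] := leP (sqnorm x) 1.
  rewrite mulr1; split.
    rewrite distrC (le_trans (normr_1Bcos_le2 _))// (le_trans h)// ler_wpM2r//; lra.
  by rewrite (le_trans (normr_sinB_le _))// (le_trans h)// ler_wpM2r//; lra.
rewrite mulr0 subr0 mulr1.
have := sin_max (dotp t x); have := cos_max (dotp t x); split; last by lra.
by rewrite (le_trans (ler_normB _ _))// normr1; lra.
Qed.

Let mdotp t := @measurable_dotp R n t.

Let mcosB t : measurable_fun setT (fun x => cos (dotp t x) - 1).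
Proof. by have := mdotp t => ?; mfun. Qed.

Let msinB t : measurable_fun setT (fun x => sin (dotp t x) - dotp t x * trunc x).
Proof. by have := mdotp t => ?; mfun. Qed.

Let row_bound t : exists K, forall i, `|t 0 i| <= K.
Proof.
exists (\sum_i `|t 0 i|) => i.
by rewrite (bigD1 i)//= lerDl sumr_ge0.
Qed.

(** This term is the cost of replacing the truncated compensator by the full one. It lives where
    [sqnorm x > 1], and there an absolute value is at most 1 plus the square. *)
Lemma integrable_lk_drift t :
  nu.-integrable setT (EFin \o (fun x => dotp t x ^+ 2)) ->
  nu.-integrable setT (EFin \o (fun x => dotp t x * (1 - (sqnorm x <= 1)%R%:R))).
Proof.
move=> i2; have := mdotp t => mt.
apply: (ge0_le_integrable (g := fun x => Num.min 1 (sqnorm x) + dotp t x ^+ 2)).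
- by rewrite -/(trunc _); mfun.
- move=> x; have [s1|s1] := leP (sqnorm x) 1.
    by rewrite subrr mulr0 normr0 addr_ge0 ?sqr_ge0 ?sqnorm_ge0.
  rewrite subr0 mulr1 -(real_normK (num_real (dotp t x))).
  by have := sqr_ge0 (`|dotp t x| - 1); have := normr_ge0 (dotp t x); nra.
- exact: integrable_addf.
Qed.

Lemma lk_continuous : continuous lk_re /\ continuous lk_im.
Proof.
have main t (u : nat -> 'rV[R]_n) (h : forall k i, `|t 0 i - u k 0 i| < k.+1%:R^-1) :
    (fun k => lk_re (u k)) @ \oo --> lk_re t /\ (fun k => lk_im (u k)) @ \oo --> lk_im t.
  have ut i : (fun k => u k 0 i) @ \oo --> t 0 i by apply: cvg_of_inv_bound => k.
  have [K tK] := row_bound t.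
  (* The rate [1 / k.+1] is at most 1, so the whole sequence shares one entry bound and one
     dominating function. *)
  have uK k i : `|u k 0 i| <= K + 1.
    rewrite -[u k 0 i](subKr (t 0 i)) (le_trans (ler_normB _ _))// lerD//.
    by rewrite (le_trans (ltW (h k i)))// invf_le1// ler1n.
  have ig := integrable_scalef (((K + 1) * n%:R) ^+ 2 + 2) imin.
  have cd x : (fun k => dotp (u k) x) @ \oo --> dotp t x := @cvg_dotp R n u t x ut.
  split; apply: cvgD.
  - by apply: cvgN; apply: cvgMl; exact: (@cvg_qform R n A u t ut).
  - refine (@dominated_cvg_Rintegral _ _ R nu (fun k x => cos (dotp (u k) x) - 1)
      (fun x => cos (dotp t x) - 1) _ (fun k => mcosB (u k)) (mcosB t) ig _ _).
      by move=> k x; have [] := min_bound x (uK k).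
    move=> x; apply: cvgB; last exact: cvg_cst.
    by apply: cvg_comp (cd x) _; exact: continuous_cos.
  - exact: (@cvg_dotp R n u t gamma ut).
  - refine (@dominated_cvg_Rintegral _ _ R nu
      (fun k x => sin (dotp (u k) x) - dotp (u k) x * trunc x)
      (fun x => sin (dotp t x) - dotp t x * trunc x) _
      (fun k => msinB (u k)) (msinB t) ig _ _).
      by move=> k x; have [] := min_bound x (uK k).
    move=> x; apply: cvgB.
      by apply: cvg_comp (cd x) _; exact: continuous_sin.
    by apply: cvgMl; exact: cd.
by split; apply: row_seq_continuous => t u h; have [] := main t u h.
Qed.

Lemma lk_0 : lk_re 0 = 0 /\ lk_im 0 = 0.
Proof.
have d0 x : dotp (0 : 'rV[R]_n) x = 0.
  by rewrite /dotp big1// => i _; rewrite mxE mul0r.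
split; rewrite /lk_re /lk_im.
  have -> : qform A 0 = 0 by rewrite /qform !mul0mx mxE.
  under eq_Rintegral do rewrite d0 cos0 subrr.
  by rewrite Rintegral_cst// mul0r mul0r oppr0 addr0.
under eq_Rintegral do rewrite d0 sin0 mul0r subrr.
by rewrite Rintegral_cst// mul0r d0 addr0.
Qed.

End LevyKhintchine.

(** * Mean and variance of the projection on a direction *)

Section Moments.
Context (d : measure_display) (T : measurableType d) (R : realType).
Context (P : probability T R).

Lemma Rintegral_bigsum (I : Type) (r : seq I) (f : I -> T -> R) :
  (forall i, P.-integrable setT (EFin \o f i)) ->
  P.-integrable setT (EFin \o (fun x => \sum_(i <- r) f i x)) /\
  \int[P]_x (\sum_(i <- r) f i x) = \sum_(i <- r) \int[P]_x f i x.
Proof.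
move=> fi; elim: r => [|i r [ir er]].
  split; last by rewrite big_nil -[RHS](prob_Rintegral_cst P); apply: eq_Rintegral => x _; rewrite big_nil.
  rewrite (_ : (fun x => _) = fun=> 0); last by apply/funext => x; rewrite big_nil.
  by apply: (@prob_bounded_integrable _ _ _ P _ 0) => // x; rewrite normr0.
have -> : (fun x => \sum_(j <- i :: r) f j x) = (fun x => f i x + \sum_(j <- r) f j x).
  by apply/funext => x; rewrite big_cons.
by split; [exact: integrable_addf|rewrite RintegralD// er big_cons].
Qed.

Context (n : nat) (X : {RV P >-> n.-tuple R}).
Hypotheses (hc : centered X) (hm : finite_second_moment X).

Let mX i : measurable_fun setT (fun w => tnth (X w) i).
Proof. exact: (measurableT_comp (measurable_tnth i)). Qed.

Let isq : P.-integrable setT (EFin \o (fun w => sqnorm (X w))).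
Proof.
apply: integrable_ge0_lty => [|x|]; last by move: hm; rewrite /finite_second_moment unlock.
  exact: (measurableT_comp measurable_sqnorm).
exact: sqnorm_ge0.
Qed.

Let iXX i j : P.-integrable setT (EFin \o (fun w => tnth (X w) i * tnth (X w) j)).
Proof.
apply: (ge0_le_integrable _ _ isq); first by apply: measurable_mulf.
move=> w; have := sqr_tnth_le (X w) i; have := sqr_tnth_le (X w) j.
rewrite normrM -(real_normK (num_real (tnth (X w) i))) -(real_normK (num_real (tnth (X w) j))).
by have := sqr_ge0 (`|tnth (X w) i| - `|tnth (X w) j|); nra.
Qed.

Let iX i : P.-integrable setT (EFin \o (fun w => tnth (X w) i)).
Proof.
have i1 : P.-integrable setT (EFin \o (fun=> 1)).
  by apply: (@prob_bounded_integrable _ _ _ P _ 1) => // x; rewrite normr1.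
apply: (ge0_le_integrable (mX i) _ (integrable_addf i1 (iXX i i))) => w.
rewrite -expr2 -(real_normK (num_real (tnth (X w) i))).
by have := sqr_ge0 (`|tnth (X w) i| - 1); have := normr_ge0 (tnth (X w) i); nra.
Qed.

Let EX i : \int[P]_w tnth (X w) i = 0.
Proof. by have := hc i; rewrite unlock /Rintegral => ->. Qed.

Let covE i j : covariance_matrix X i j = \int[P]_w (tnth (X w) i * tnth (X w) j).
Proof.
rewrite /covariance_matrix mxE unlock !hc/= unlock; congr fine.
apply: eq_integral => w _ /=; congr EFin.
by rewrite -[LHS]/((tnth (X w) i - 0) * (tnth (X w) j - 0)) !subr0.
Qed.

Lemma dotp_moments t :
  [/\ P.-integrable setT (EFin \o (fun w => dotp t (X w))),
      P.-integrable setT (EFin \o (fun w => dotp t (X w) ^+ 2)),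
      \int[P]_w dotp t (X w) = 0 &
      \int[P]_w (dotp t (X w) ^+ 2) = Vfun X t].
Proof.
have i1 i := integrable_scalef (t 0 i) (iX i).
have [j1 e1] := @Rintegral_bigsum _ (index_enum 'I_n) _ i1.
have i2 i j := integrable_scalef (t 0 i * t 0 j) (iXX i j).
have r2 i := @Rintegral_bigsum _ (index_enum 'I_n) _ (i2 i).
have [j2 e2] := @Rintegral_bigsum _ (index_enum 'I_n) _ (fun i => (r2 i).1).
have sqE : (fun w => dotp t (X w) ^+ 2) = (fun w => \sum_(i < n) \sum_(j < n)
    t 0 i * t 0 j * (tnth (X w) i * tnth (X w) j)).
  apply/funext => w; rewrite expr2 {1}/dotp mulr_suml; apply: eq_bigr => i _.
  by rewrite /dotp mulr_sumr; apply: eq_bigr => j _; rewrite mulrACA.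
split => //.
- by rewrite sqE.
- rewrite /dotp e1 big1// => i _; rewrite RintegralZl// EX mulr0//.
- rewrite sqE e2 /Vfun qformE; apply: eq_bigr => i _; rewrite (r2 i).2.
  apply: eq_bigr => j _; rewrite RintegralZl// covE; ring.
Qed.

End Moments.

(** [D] takes values in the multiples of [2 * pi]. Were [D r] nonzero, the intermediate value
    theorem would give a point where the absolute value of [D] lies in []0, 1]], and there the
    cosine is not 1. *)
Lemma cos_eq1_continuous (R : realType) (D : R -> R) : continuous D -> D 0 = 0 ->
  (forall r, cos (D r) = 1) -> forall r, D r = 0.
Proof.
move=> cD D0 c1 r; apply/eqP/negPn/negP => Dr.
have cos1 (v : R) : 0 <= v <= 1 -> cos v = 1 -> v = 0.
  move=> /andP[v0 v1] cv; have p2 := pi_ge2 R; apply: cos_inj.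
  - by rewrite in_itv/= v0/=; lra.
  - by rewrite in_itv/= lexx/=; lra.
  - by rewrite cv cos0.
pose E x := `|D x|.
have cE : continuous E.
  by move=> x; apply: cvg_comp (cD x) _; exact: norm_continuous.
(* The cap 1 is below [pi], so injectivity of [cos] on [[0, pi]] applies to [v]. *)
pose v := Num.min 1 `|D r|.
have v0 : 0 < v by rewrite lt_min ltr01 normr_gt0.
have E0 : E 0 = 0 by rewrite /E D0 normr0.
have Er0 : 0 <= E r by exact: normr_ge0.
have vr : v <= E r by rewrite ge_min lexx orbT.
have [x xv] : exists x, E x = v.
  have [r0|r0] := leP 0 r.
    have [//||x _ xv] := @IVT R E 0 r v r0; [exact: continuous_subspaceT| |by exists x].
    by rewrite E0 min_l// max_r// vr (ltW v0).
  have [//||x _ xv] := @IVT R E r 0 v (ltW r0); [exact: continuous_subspaceT| |by exists x].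
  by rewrite E0 min_r// max_l// vr (ltW v0).
have : v = 0.
  apply: cos1; first by rewrite (ltW v0) ge_min lexx.
  rewrite -xv /E; have [h|h] := leP 0 (D x); first by rewrite ger0_norm.
  by rewrite ltr0_norm// cosN.
by move/eqP; rewrite gt_eqF.
Qed.

Lemma charfunE (d : measure_display) (T : measurableType d) (R : realType)
    (P : probability T R) (n : nat) (X : {RV P >-> n.-tuple R}) t :
  charfun X t = Complex (\int[P]_w cos (dotp t (X w))) (\int[P]_w sin (dotp t (X w))).
Proof.
by congr Complex; apply: eq_Rintegral => w _ /=; rewrite expR0 mul1r.
Qed.

Lemma levy_khintchineE (R : realType) (n : nat) (A : 'M[R]_n)
    (nu : {measure set (n.-tuple R) -> \bar R}) (gamma : n.-tuple R) (t : 'rV[R]_n) :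
  Complex (- (qform A t / 2)) (dotp t gamma) + cintegral nu (fun x =>
    cexp (Complex 0 (dotp t x)) - 1 - Complex 0 (dotp t x * (sqnorm x <= 1)%R%:R)) =
  Complex (lk_re A nu t) (lk_im nu gamma t).
Proof.
rewrite /cintegral; congr Complex; congr (_ + _).
  by apply: eq_Rintegral => x _ /=; rewrite expR0 mul1r subr0.
by apply: eq_Rintegral => x _ /=; rewrite expR0 mul1r subr0.
Qed.

(** Moduli give the real parts; the remaining equality of points of the unit circle is recorded in
    the form that [cos_eq1_continuous] consumes. *)
Lemma cexp_eq (R : realType) (a b a' b' : R) :
  cexp (Complex a b) = cexp (Complex a' b') -> a = a' /\ cos (b - b') = 1.
Proof.
move=> [] hc hs.
have sq z y : (expR z * cos y) ^+ 2 + (expR z * sin y) ^+ 2 = expR z ^+ 2 :> R.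
  by rewrite !exprMn -mulrDr cos2Dsin2 mulr1.
have e : expR a = expR a'.
  apply/eqP; rewrite -(eqrXn2 (n := 2))// ?expR_ge0//; apply/eqP.
  by rewrite -(sq a b) hc hs sq.
split; first exact: expR_inj e.
have e0 := lt0r_neq0 (expR_gt0 a'); rewrite e in hc hs.
by rewrite cosB (mulfI e0 hc) (mulfI e0 hs) -!expr2 cos2Dsin2.
Qed.


(** Everything is transported to the projection [dotp t] of the vector and of its jumps, where the
    one-dimensional results apply. Only the existence of a continuous logarithm is argued on the
    whole row space. *)
Theorem theorem2p2 (R : realType)
    (d : measure_display) (T : measurableType d) (P : probability T R)
    (n : nat) (X : {RV P >-> n.-tuple R})
    (hcentered : centered X)
    (hmoment : finite_second_moment X)
    (hid : infinitely_divisible X)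
    (A : 'M[R]_n) (nu : {measure set (n.-tuple R) -> \bar R})
    (hpair : gaussian_levy_pair X A nu)
    (t : 'rV[R]_n) (hV : 0 < Vfun X t)
    (d' : measure_display) (T' : measurableType d') (Q : probability T' R)
    (B Y : {RV Q >-> R})
    (hB : beta12_law B)
    (hY : forall S : set R, measurable S ->
      distribution Q Y S = (Hmeas A nu t S * ((Vfun X t)^-1)%:E)%E)
    (hBY : independent_pair B Y) :
  let Rt := fun w : T' => B w * Y w in
  (forall s : R, 0 <= s ->
     cumulant X (s *: t) =
     ((Vfun X t * s ^+ 2 / 2)%:E * mmt_gen_fun Q Rt s)%E) /\
  (forall r : R,
     char_exponent X (r *: t) =
     - (Complex (Vfun X t * r ^+ 2 / 2) 0 * cf Q Rt r)).
Proof.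
case: hpair => _ Apos hnu [gamma hLK].
have [iZ iZ2 EZ EZ2] := dotp_moments hcentered hmoment t.
have mZ : measurable_fun setT (fun w => dotp t (X w)).
  exact: (measurableT_comp (measurable_dotp t)).
have mu := measurable_dotp t.
have [iu _] := directional_variance mu (Apos t) hV hY.
(* The total drift once jumps are compensated by [dotp t x] itself instead of its truncation; the
   correction is integrable by [iu]. *)
pose c := dotp t gamma + \int[nu]_x (dotp t x * (1 - (sqnorm x <= 1)%R%:R)).
pose C r := qform A t * r ^+ 2 / 2 + \int[nu]_x (1 - cos (r * dotp t x)).
pose S r := \int[nu]_x (sin (r * dotp t x) - r * dotp t x).
have intlin r : nu.-integrable setT (EFin \o (fun x => sin (r * dotp t x) - r * dotp t x)).
  apply: (ge0_le_integrable (g := fun x => r ^+ 2 * dotp t x ^+ 2)).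
  - by mfun.
  - by move=> x; rewrite -exprMn normr_sinB_le.
  - exact: integrable_scalef.
have intcos r : nu.-integrable setT (EFin \o (fun x => 1 - cos (r * dotp t x))).
  apply: (ge0_le_integrable (g := fun x => r ^+ 2 * dotp t x ^+ 2)).
  - by mfun.
  - by move=> x; rewrite -exprMn normr_1Bcos_le2.
  - exact: integrable_scalef.
have reE r : lk_re A nu (r *: t) = - C r.
  rewrite /lk_re /C qformZ opprD; congr (_ + _); first by rewrite [r ^+ 2 * _]mulrC.
  rewrite -[RHS]mulN1r -RintegralZl//.
  by apply: eq_Rintegral => x _; rewrite dotpZ; ring.
have imE r : lk_im nu gamma (r *: t) = S r + r * c.
  have idr := integrable_scalef r (integrable_lk_drift hnu iu).
  rewrite /lk_im /S /c dotpZ mulrDr addrCA; congr (_ + _).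
  rewrite -RintegralZl//; last exact: integrable_lk_drift.
  rewrite -RintegralD//; apply: eq_Rintegral => x _; rewrite dotpZ; ring.
have cfE s : charfun X s = cexp (Complex (lk_re A nu s) (lk_im nu gamma s)).
  by rewrite hLK levy_khintchineE.
have cosZ r : \int[P]_w cos (r * dotp t (X w)) = expR (- C r) * cos (S r + r * c).
  have := congr1 (@complex.Re R) (cfE (r *: t)); rewrite charfunE reE imE /= => <-.
  by apply: eq_Rintegral => w _; rewrite dotpZ.
have sinZ r : \int[P]_w sin (r * dotp t (X w)) = expR (- C r) * sin (S r + r * c).
  have := congr1 (@complex.Im R) (cfE (r *: t)); rewrite charfunE reE imE /= => <-.
  by apply: eq_Rintegral => w _; rewrite dotpZ.
have cumE := one_dim_cumulant mZ iZ iZ2 EZ EZ2 mu (Apos t) hV hB hY hBY cosZ sinZ.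
have chfE := one_dim_charfun mZ iZ EZ mu (Apos t) hV hB hY hBY cosZ sinZ.
move=> Rt; split => [s s0|r].
  rewrite /cumulant /mmt_gen_fun unlock.
  have := cumE s s0; under [in X in X -> _]eq_integral do rewrite -dotpZ.
  move=> ->; congr (_ * _)%E; apply: eq_integral => w _ /=.
  by rewrite /Rt mulrC.
(* [char_exponent] is a choice with a default value, so a continuous logarithm must be exhibited
   before its properties are available. *)
have lkP : is_char_exponent X (fun s => Complex (lk_re A nu s) (lk_im nu gamma s)).
  have [c1 c2] := lk_continuous A gamma hnu; have [z1 z2] := lk_0 A nu gamma.
  by split => //; rewrite z1 z2.
have [cre cim p0 pE] : is_char_exponent X (char_exponent X).
  by apply: xgetPex; exists (fun s => Complex (lk_re A nu s) (lk_im nu gamma s)).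
(* Along the ray through [t] the chosen exponent and that of the triplet have the same exponential,
   so their imaginary parts can differ only by multiples of [2 * pi], which continuity and the value
   at 0 exclude next. *)
have eq1 q : complex.Re (char_exponent X (q *: t)) = - C q /\
    cos (complex.Im (char_exponent X (q *: t)) - (S q + q * c)) = 1.
  apply: cexp_eq; rewrite -reE -imE -cfE -pE.
  by case: (char_exponent X (q *: t)).
have imS : complex.Im (char_exponent X (r *: t)) = S r + r * c.
  apply/eqP; rewrite -subr_eq0; apply/eqP.
  pose D q := complex.Im (char_exponent X (q *: t)) - (S q + q * c).
  have cS := one_dim_phase_continuous mu (Apos t) hV hY.
  rewrite -[LHS]/(D r); apply: cos_eq1_continuous => [q||q]; last by have [] := eq1 q.
    apply: cvgB.
      have cl : continuous (fun q : R => q *: t) by apply: scalel_continuous.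
      exact: (cvg_comp (fun q : R => q *: t) _ (cl q) (cim _)).
    by apply: cvgD; [exact: cS|apply: cvgMl; exact: cvg_id].
  rewrite /D scale0r p0 mul0r addr0 /S.
  under eq_Rintegral do rewrite !mul0r sin0 subr0.
  by rewrite Rintegral_cst// mul0r subr0.
have [reC _] := eq1 r.
have [CE SE] := chfE r.
have -> : cf Q Rt r = Complex (\int[Q]_w cos (r * (B w * Y w)))
    (\int[Q]_w sin (r * (B w * Y w))).
  by congr Complex; apply: eq_Rintegral => w _ /=; rewrite expR0 mul1r.
move: reC imS; case: (char_exponent X (r *: t)) => a b /= -> ->.
rewrite -/(C r) in CE; rewrite -/(S r) in SE.
by congr Complex; rewrite ?CE ?SE; ring.
Qed.
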